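(* Let $w=(w_k)_{k\ge0}$ be a weight sequence with $w_0>0$ and $w_k>0$ for some $k\ge1$. Suppose that $n\to\infty$ and $m=m(n)$ with $m/n\to\lambda$, where $0\le\lambda<\omega$, and let $\tau$ be the unique number in $[0,\rho]$ with $\Psi(\tau)=\lambda$ if $\lambda\le\nu$, and $\tau=\rho$ if $\lambda>\nu$. Then $$\frac{Z(m,n+1)}{Z(m,n)}\to\Phi(\tau).$$
   Context: A weight sequence is a sequence $w=(w_k)_{k\ge0}$ of nonnegative reals; $\omega=\sup\{k:w_k>0\}$. $\Phi(t)=\sum_kw_kt^k$, $\rho$ its radius of convergence; $\Psi(t)=t\Phi'(t)/\Phi(t)$ for $\Phi(t)<\infty$, $\Psi(\rho)=\lim_{t\uparrow\rho}\Psi(t)$ if $\Phi(\rho)=\infty$; $\nu=\Psi(\rho)$. $Z(m,n)=\sum\prod_{i=1}^nw_{y_i}$ over all $(y_1,\dots,y_n)\in\{0,1,\dots\}^n$ with $\sum y_i=m$; the limit is along $n$ with $Z(m,n)>0$. *)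

(* Defs.v *)
From mathcomp Require Import all_boot all_order all_algebra.
From mathcomp Require Import all_classical all_reals all_analysis.
Set Implicit Arguments. Unset Strict Implicit. Unset Printing Implicit Defensive.
Import Order.TTheory GRing.Theory Num.Theory.
Import numFieldNormedType.Exports.
Local Open Scope classical_set_scope.
Local Open Scope ring_scope.

Section WeightSeq.
Variable R : realType.
Variable w : nat -> R.

Definition weight_seq := forall k, 0 <= w k.

Definition omega_w : \bar R :=
  ereal_sup [set ((k%:R : R)%:E) | k in [set k : nat | 0 < w k]].

Definition Phi (t : R) : \bar R := (\sum_(0 <= k <oo) (w k * t ^+ k)%:E)%E.

Definition tPhi' (t : R) : \bar R :=
  (\sum_(0 <= k <oo) ((k%:R * w k) * t ^+ k)%:E)%E.

(* radius of convergence (for nonnegative coefficients):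
   sup of the t >= 0 at which the series converges *)
Definition rho_w : \bar R :=
  ereal_sup [set t%:E | t in [set t : R | 0 <= t /\ (Phi t < +oo)%E]].

Definition Psi (t : R) : \bar R := (tPhi' t * (Phi t)^-1)%E.

Definition nu_w : \bar R :=
  match rho_w with
  | r%:E => if (Phi r < +oo)%E then Psi r else lim (Psi t @[t --> r^'-])
  | +oo%E => lim (Psi t @[t --> +oo])
  | -oo%E => 0%E
  end.

(* Psi extended to [0, rho]: at a point where Phi = oo (only possibly t = rho)
   it is the limit nu *)
Definition Psi_bar (t : R) : \bar R :=
  if (Phi t < +oo)%E then Psi t else nu_w.

(* Z(m,n) = sum over (y_1..y_n) in N^n with sum m of prod w_{y_i};
   each y_i <= m, so y ranges over functions 'I_n -> 'I_(m+1) *)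
Definition Z (m n : nat) : R :=
  \sum_(y : {ffun 'I_n -> 'I_m.+1} | (\sum_(i < n) (y i : nat))%N == m)
     \prod_(i < n) w (y i).

End WeightSeq.

(* Main.v *)
Require Import Defs.
From mathcomp Require Import all_boot all_order all_algebra.
From mathcomp Require Import all_classical all_reals all_analysis.
From mathcomp Require Import zify ring lra.
Import Order.TTheory GRing.Theory Num.Theory.
Import numFieldNormedType.Exports.
Local Open Scope classical_set_scope.
Local Open Scope ring_scope.

(* [w 0 * Z(m,n) / Z(m,n+1)] is the probability that a given part of a random allocation
   of [m] into [n+1] parts, weighted by [w], vanishes ([zero_part_cvg]);
   it has to tend to [w 0 / Phi tau].
   If [tau > 0], rescale to [tau = 1] and put [F = Phi tau].  Truncating the weights at a
   large [K] and tilting them to mean [lam] gives [Z(m,n) >= exp(-o(n)) F^n] whenever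
   [Z(m,n) > 0], the truncation being what handles the condensation regime
   [lam > nu].  Jensen's inequality for the exponential moments of the number of
   vanishing parts, together with the trivial bound on the allocation sum in which [w 0]
   is replaced by [exp(h) w 0], then pins down the mean of that number.
   If [tau = 0], then either [lam = 0], when almost all parts vanish, or the radius of
   convergence is [0], when trading [k] parts equal to [a] for [a] parts equal to a huge
   [k] and [k - a] zeros shows that parts equal to [a] are rare.
   [Phi tau] is never infinite, since it could only be so at [tau = rho], where then
   [nu = +oo]. *)

(** * The coefficientwise order on polynomials *)

Definition coef_le {R : realType} (p q : {poly R}) := forall i, p`_i <= q`_i.

Lemma coef_leD {R : realType} (p q p' q' : {poly R}) :
  coef_le p q -> coef_le p' q' -> coef_le (p + p') (q + q').
Proof. by move=> pq pq' i; rewrite !coefD lerD. Qed.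

Lemma coef_le0M {R : realType} (p q : {poly R}) :
  coef_le 0 p -> coef_le 0 q -> coef_le 0 (p * q).
Proof.
move=> p0 q0 i; rewrite coef0 coefM sumr_ge0 // => j _.
by rewrite mulr_ge0 //; [have := p0 j | have := q0 (i - j)%N]; rewrite coef0.
Qed.

Lemma coef_leM {R : realType} (p q p' q' : {poly R}) :
  coef_le 0 p -> coef_le 0 p' -> coef_le p q -> coef_le p' q' ->
  coef_le (p * p') (q * q').
Proof.
move=> p0 p'0 pq pq' i; rewrite !coefM ler_sum // => j _.
by rewrite ler_pM //; [have := p0 j | have := p'0 (i - j)%N]; rewrite coef0.
Qed.

Lemma coef_le0X {R : realType} (p : {poly R}) n :
  coef_le 0 p -> coef_le 0 (p ^+ n).
Proof.
move=> p0; elim: n => [|n ih]; last by rewrite exprS; exact: coef_le0M.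
by move=> i; rewrite expr0 coef0 coef1; case: eqP.
Qed.

Lemma coef_leX {R : realType} (p q : {poly R}) n :
  coef_le 0 p -> coef_le p q -> coef_le (p ^+ n) (q ^+ n).
Proof.
move=> p0 pq; elim: n => [|n ih]; first by rewrite !expr0.
by rewrite !exprS; apply: coef_leM => //; exact: coef_le0X.
Qed.

Lemma coef_mul_ge {R : realType} (p q : {poly R}) i j :
  coef_le 0 p -> coef_le 0 q -> p`_i * q`_j <= (p * q)`_(i + j).
Proof.
move=> p0 q0; rewrite coefM.
have ilt : (i < (i + j).+1)%N by lia.
rewrite (bigD1 (Ordinal ilt)) //= addKn lerDl sumr_ge0 // => l _.
by rewrite mulr_ge0 //; [have := p0 l | have := q0 (i + j - l)%N]; rewrite coef0.
Qed.

Lemma coef_le_horner {R : realType} (p : {poly R}) (t : R) i :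
  coef_le 0 p -> 0 <= t -> p`_i * t ^+ i <= p.[t].
Proof.
move=> p0 t0; have p0' j : 0 <= p`_j by have := p0 j; rewrite coef0.
have [ip|pi] := ltnP i (size p).
  rewrite horner_coef (bigD1 (Ordinal ip)) //= lerDl sumr_ge0 // => j _.
  by rewrite mulr_ge0 ?exprn_ge0.
by rewrite nth_default // mul0r horner_coef sumr_ge0 // => j _; rewrite mulr_ge0 ?exprn_ge0.
Qed.

(** * Allocation sums as coefficients of powers of a truncated generating function *)

Definition wpoly {R : realType} (w : nat -> R) (N : nat) : {poly R} :=
  \poly_(i < N) w i.

Lemma wpoly_ge0 {R : realType} (w : nat -> R) N :
  weight_seq w -> coef_le 0 (wpoly w N).
Proof. by move=> w0 i; rewrite coef0 coef_poly; case: ifP. Qed.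

Lemma wpoly_le {R : realType} (w : nat -> R) N N' :
  weight_seq w -> (N <= N')%N -> coef_le (wpoly w N) (wpoly w N').
Proof.
move=> w0 NN' i; rewrite !coef_poly; case: ifP => [iN|_]; last by case: ifP.
by rewrite (leq_trans iN NN').
Qed.

Lemma horner_wpoly {R : realType} (w : nat -> R) N t :
  (wpoly w N).[t] = \sum_(k < N) w k * t ^+ k.
Proof. exact: horner_poly. Qed.

Lemma coef_exp_ext {R : realType} (p q : {poly R}) m n :
  (forall i, (i <= m)%N -> p`_i = q`_i) -> (p ^+ n)`_m = (q ^+ n)`_m.
Proof.
elim: n m => [|n ih] m pq; first by rewrite !expr0.
rewrite !exprS !coefM; apply: eq_bigr => j _; rewrite pq; last by have := ltn_ord j; lia.
by congr (_ * _); apply: ih => i im; apply: pq; lia.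
Qed.

(** Distributing the power over its [n] factors turns each choice of monomials into one [y], whose
    degree is its total. The freedom in [N] lets allocation sums with different totals be read off
    powers of one polynomial. *)
Lemma Z_coef {R : realType} (w : nat -> R) m n N :
  (m < N)%N -> Z w m n = (wpoly w N ^+ n)`_m.
Proof.
move=> mN; rewrite (coef_exp_ext _ (wpoly w m.+1)); last first.
  by move=> i im; rewrite !coef_poly ltnS im (leq_ltn_trans im mN).
rewrite -[n in RHS]card_ord -prodr_const /wpoly poly_def bigA_distr_bigA coef_sum.
rewrite /Z [LHS]big_mkcond; apply: eq_bigr => y _.
have -> : \prod_(i < n) (w (y i) *: 'X^(y i)) = \prod_(i < n) ((w (y i))%:P * 'X^(y i)).
  by apply: eq_bigr => i _; rewrite mul_polyC.
rewrite big_split /= -rmorph_prod mul_polyC coefZ -expr_sum coefXn eq_sym.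
by case: eqP => _; rewrite ?mulr1 ?mulr0.
Qed.

Lemma Z_ge0 {R : realType} (w : nat -> R) m n : weight_seq w -> 0 <= Z w m n.
Proof. by move=> w0; rewrite sumr_ge0 // => y _; rewrite prodr_ge0. Qed.

Lemma coef_exp_le_Z {R : realType} (w : nat -> R) m n K :
  weight_seq w -> (wpoly w K ^+ n)`_m <= Z w m n.
Proof.
move=> w0; rewrite (@Z_coef _ _ _ _ (m.+1 + K)) ?leq_addr //.
by apply: coef_leX; [exact: wpoly_ge0 | apply: wpoly_le => //; rewrite leq_addl].
Qed.

(** An allocation of [m1] followed by one of [m2] is an allocation of [m1 + m2], and distinct pairs
    stay distinct. *)
Lemma Z_supermul {R : realType} (w : nat -> R) m1 n1 m2 n2 : weight_seq w ->
  Z w m1 n1 * Z w m2 n2 <= Z w (m1 + m2) (n1 + n2).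
Proof.
move=> w0; rewrite !(@Z_coef _ _ _ _ (m1 + m2).+1) ?ltnS ?leq_addr ?leq_addl //.
by rewrite exprD; apply: coef_mul_ge; apply/coef_le0X/wpoly_ge0.
Qed.

Lemma Z1 {R : realType} (w : nat -> R) k : Z w k 1 = w k.
Proof. by rewrite (@Z_coef _ _ _ _ k.+1) // expr1 coef_poly ltnSn. Qed.

Lemma Z00 {R : realType} (w : nat -> R) : Z w 0 0 = 1.
Proof. by rewrite (@Z_coef _ _ _ _ 1) // expr0 coef1. Qed.

Lemma Z_mul {R : realType} (w : nat -> R) m n q : weight_seq w ->
  Z w m n ^+ q <= Z w (q * m) (q * n).
Proof.
move=> w0; elim: q => [|q ih]; first by rewrite expr0 Z00.
rewrite exprS !mulSn; apply: le_trans (Z_supermul _ _ _ _ _ w0).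
by rewrite ler_wpM2l // Z_ge0.
Qed.

(** All allocations of [m] pick up the same factor, so ratios at a fixed [m] do not change; this is
    what permits rescaling to [tau = 1]. *)
Lemma Z_scale {R : realType} (w : nat -> R) (t : R) m n :
  Z (fun k => w k * t ^+ k) m n = t ^+ m * Z w m n.
Proof.
rewrite /Z big_distrr /=; apply: eq_bigr => y /eqP ym.
by rewrite big_split /= -expr_sum ym mulrC.
Qed.

Lemma Z_recl {R : realType} (w : nat -> R) m n :
  Z w m n.+1 = \sum_(a < m.+1) w a * Z w (m - a) n.
Proof.
rewrite (@Z_coef _ _ _ _ m.+1) // exprS coefM; apply: eq_bigr => a _.
rewrite coef_poly ltn_ord; congr (_ * _).
by rewrite -Z_coef // ltnS leq_subr.
Qed.

(* Coefficients of X (p^(n+1))' = (n+1) X p' p^n: the mean of one part is m/(n+1). *)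
Lemma Z_mean {R : realType} (w : nat -> R) m n :
  n.+1%:R * (\sum_(a < m.+1) a%:R * (w a * Z w (m - a) n)) = m%:R * Z w m n.+1.
Proof.
case: m => [|m]; first by rewrite big_ord_recl big_ord0 !mul0r addr0 mulr0.
rewrite big_ord_recl mul0r add0r (@Z_coef _ _ _ _ m.+2) //.
have -> : m.+1%:R * (wpoly w m.+2 ^+ n.+1)`_m.+1 = (wpoly w m.+2 ^+ n.+1)^`()`_m.
  by rewrite coef_deriv mulr_natl.
rewrite deriv_exp coefMn -[X in _ = X]mulr_natl /=.
congr (_ * _); rewrite coefM; apply: eq_bigr => a _.
rewrite coef_deriv coef_poly /bump leq0n add1n ltnS ltn_ord -[w _ *+ _]mulr_natl -mulrA.
by rewrite subSS (@Z_coef _ _ (m - a) n m.+2) // ltnS; lia.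
Qed.

(** * Exponential estimates and a crude geometric lower bound *)

Lemma eventually_ge_nat {R : realType} (r : R) :
  exists N : nat, forall n, (N <= n)%N -> r <= n%:R.
Proof.
exists (Num.bound `|r|) => n Nn; apply: le_trans (ler_norm _) _.
by apply: le_trans (ltW (archi_boundP (normr_ge0 r))) _; rewrite ler_nat.
Qed.

(** Squaring [1 + y <= expR y] at [y = e * n / 2] yields a quadratic term in [n], which beats
    [K * n]. *)
Lemma affine_lt_expR {R : realType} (e : R) (K : nat) : 0 < e ->
  exists N : nat, forall n, (N <= n)%N -> (K * n + 1)%:R < expR (e * n%:R).
Proof.
move=> e0; have [N HN] := eventually_ge_nat (4 * K%:R / e ^+ 2 + 1).
exists N => n /HN Hn.
have K0 : 0 <= K%:R :> R by [].
have n1 : 1 <= n%:R :> R.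
  by apply: le_trans Hn; rewrite lerDr divr_ge0 ?exprn_ge0 ?mulr_ge0 // ltW.
have Kn : 4 * K%:R <= n%:R * e ^+ 2.
  by rewrite -ler_pdivrMr ?exprn_gt0 //; apply: le_trans Hn; rewrite lerDl.
have -> : e * n%:R = e * n%:R / 2 + e * n%:R / 2 by lra.
have E : 1 + e * n%:R / 2 <= expR (e * n%:R / 2) := expR_ge1Dx _.
have en : 0 < e * n%:R by rewrite mulr_gt0 // (lt_le_trans ltr01).
rewrite expRD natrD natrM.
apply: lt_le_trans (_ : (1 + e * n%:R / 2) * (1 + e * n%:R / 2) <= _); last first.
  by apply: ler_pM => //; lra.
have := ler_wpM2l (ltW (lt_le_trans ltr01 n1)) Kn; nra.
Qed.

(** Since [expR (- u) >= 1 - u], it is enough that [(1 - u) * (1 + u + 2 * u ^+ 2) = 1 + u ^+ 2 * (1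
    - 2 * u)] is at least [1]. Negative [u] of any size are covered. *)
Lemma expR_le_quad {R : realType} (u : R) :
  u <= 1 / 2 -> expR u <= 1 + u + 2 * u ^+ 2.
Proof.
move=> u2; have E := expR_ge1Dx (- u).
have E0 : 0 < expR u by exact: expR_gt0.
have EE : expR u * expR (- u) = 1 by rewrite -expRD subrr expR0.
have : expR u * (1 - u) <= expR u * expR (- u) by rewrite ler_wpM2l // ltW.
rewrite EE.
have : 1 <= (1 - u) * (1 + u + 2 * u ^+ 2).
  by have : 0 <= u ^+ 2 * (1 - 2 * u); [rewrite mulr_ge0 ?sqr_ge0 //; lra | lra].
move=> H1 H2; have H : expR u * (1 - u) <= (1 + u + 2 * u ^+ 2) * (1 - u) by lra.
by rewrite -(ler_pM2r (_ : 0 < 1 - u)) //; lra.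
Qed.

(* Once the residue of [M] modulo [k] is attainable at all, fixed parts realise it
   and parts equal to [k] and [0] do the rest. *)
Lemma Z_ge_geometric {R : realType} (w : nat -> R) k :
  weight_seq w -> 0 < w 0%N -> (0 < k)%N -> 0 < w k ->
  exists (C : nat) (c : R), 0 < c /\
    forall M N M' N', 0 < Z w M' N' -> (M' = M %[mod k])%N -> (C <= M)%N ->
      (M + k * C <= k * N)%N -> c ^+ N <= Z w M N.
Proof.
move=> w_ge0 w0 k0 wk.
(* For each residue modulo [k] that is attainable at all, [f] fixes one allocation of positive
   weight; other residues get a dummy value. *)
have /boolp.choice[f Hf] : forall r, exists u : nat * nat,
    (exists M N, 0 < Z w M N /\ (M %% k)%N = r) ->
    0 < Z w u.1 u.2 /\ (u.1 %% k)%N = r.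
  move=> r.
  have [[M [N H]]|nH] := pselect (exists M N, 0 < Z w M N /\ (M %% k)%N = r).
    by exists (M, N).
  by exists (0, 0)%N.
(* Capping at [1], with default [1] at unattainable residues, makes the product [zz] a positive
   lower bound for every factor. *)
pose z r := if 0 < Z w (f r).1 (f r).2 then Num.min 1 (Z w (f r).1 (f r).2) else 1.
have z0 r : 0 < z r by rewrite /z; case: ifP => // H; rewrite lt_min ltr01.
have z1 r : z r <= 1 by rewrite /z; case: ifP => // H; rewrite ge_min lexx.
pose zz := \prod_(r < k) z r.
have zz0 : 0 < zz by apply: prodr_gt0.
have zz1 : zz <= 1.
  rewrite /zz -[leRHS](@expr1n _ #|'I_k|) -prodr_const; apply: ler_prod => i _.
  by rewrite z1 ltW.
pose c0 := Num.min 1 (Num.min (w 0%N) (w k)).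
have c00 : 0 < c0 by rewrite !lt_min ltr01 w0 wk.
have c01 : c0 <= 1 by rewrite ge_min lexx.
have c0w : c0 <= w 0%N by rewrite !ge_min lexx orbT.
have c0k : c0 <= w k by rewrite !ge_min lexx !orbT.
exists (\sum_(r < k) ((f r).1 + (f r).2)).+1, (c0 * zz); split; first by rewrite mulr_gt0.
move=> M N M' N' Z' MM' CM MN.
set C := (\sum_(r < k) _)%N in CM MN *.
pose r := Ordinal (ltn_pmod M k0).
have [Zr fr] : 0 < Z w (f r).1 (f r).2 /\ ((f r).1 %% k)%N = r.
  by apply: Hf; exists M', N'.
have frC : ((f r).1 + (f r).2 <= C)%N by rewrite /C (bigD1 r) //= leq_addr.
(* The filling: [f r] settles the residue, then come [q] parts equal to [k] and [e] zeros. *)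
have [q Mq] : exists q, M = ((f r).1 + q * k)%N.
  have fM : ((f r).1 <= M)%N.
    by apply: leq_trans (leq_trans (leq_addr _ _) frC) (leq_trans (leqnSn _) CM).
  exists ((M - (f r).1) %/ k)%N; rewrite divnK ?subnKC // -eqn_mod_dvd //.
  by rewrite fr.
have qN : (q <= N - C.+1)%N.
  rewrite -(leq_pmul2r k0) mulnBl leq_subRL; last by move: MN (k0); clear; nia.
  by move: MN Mq; clear; nia.
have CN : (C.+1 <= N)%N by move: MN (k0); clear; nia.
have [e Ne] : exists e, N = ((f r).2 + (q + e))%N.
  by exists (N - ((f r).2 + q))%N; move: frC CN qN; clear; lia.
have -> : M = ((f r).1 + (q * k + e * 0))%N by rewrite muln0 addn0.
have -> : Z w ((f r).1 + (q * k + e * 0)) N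
    = Z w ((f r).1 + (q * k + e * 0)) ((f r).2 + (q * 1 + e * 1)) by rewrite !muln1 -Ne.
apply: le_trans (Z_supermul _ _ _ _ _ w_ge0).
apply: le_trans (_ : _ <= Z w (f r).1 (f r).2 * (Z w (q * k) (q * 1) * Z w (e * 0) (e * 1)) ) _;
  last by rewrite ler_wpM2l ?Z_ge0 //; exact: Z_supermul.
apply: le_trans (_ : _ <= Z w (f r).1 (f r).2 * (w k ^+ q * w 0%N ^+ e)) _; last first.
  rewrite ler_wpM2l ?Z_ge0 // -[w k](Z1 w) -[w 0%N](Z1 w).
  by apply: ler_pM; rewrite ?exprn_ge0 ?Z_ge0 //; exact: Z_mul.
rewrite exprMn mulrC; apply: ler_pM; rewrite ?exprn_ge0 ?(ltW zz0) ?(ltW c00) //.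
  apply: le_trans (_ : _ <= zz) _; first by
    rewrite -[leRHS]expr1; apply: ler_wiXn2l; rewrite ?(ltW zz0) // (leq_trans _ CN).
  apply: le_trans (_ : _ <= z r) _; last by rewrite /z Zr ge_min lexx orbT.
  rewrite /zz (bigD1 r) //= -[leRHS]mulr1 ler_wpM2l ?(ltW (z0 _)) //.
  rewrite -[leRHS](@expr1n _ #|predC1 r|) -prodr_const.
  by apply: ler_prod => i _; rewrite z1 ltW.
apply: le_trans (_ : _ <= c0 ^+ (q + e)) _; first by
  apply: ler_wiXn2l; rewrite ?(ltW c00) // Ne leq_addl.
rewrite exprD; apply: ler_pM; rewrite ?exprn_ge0 ?(ltW c00) //.
  by rewrite lerXn2r // nnegrE ltW.
by rewrite lerXn2r // nnegrE ltW.
Qed.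

(** * Chernoff's bound and concentration of the coefficients *)

(** One coefficient is bounded by the value of [p ^+ n] at [x * expR h]. After centring at [lam],
    the mean condition kills the linear term of [expR_le_quad]. Either sign of [h] is allowed, so
    both tails are covered. *)
Lemma coef_exp_le_Chernoff {R : realType} (p : {poly R}) K (b lam x h : R) m n :
  coef_le 0 p -> (size p <= K)%N -> 0 < x -> 0 <= b ->
  (forall k, (k < K)%N -> `|k%:R - lam| <= b) ->
  \sum_(k < K) (k%:R - lam) * (p`_k * x ^+ k) = 0 ->
  `|h| * b <= 1 / 2 ->
  (p ^+ n)`_m * x ^+ m
    <= p.[x] ^+ n * expR (2 * (h * b) ^+ 2 * n%:R - h * (m%:R - lam * n%:R)).
Proof.
move=> p0 sp x0 b0 kb mean hb.
have p0' k : 0 <= p`_k * x ^+ k.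
  by rewrite mulr_ge0 ?exprn_ge0 ?(ltW x0) //; have := p0 k; rewrite coef0.
have key : expR (- (h * lam)) * p.[x * expR h] <= p.[x] * expR (2 * (h * b) ^+ 2).
  apply: le_trans (_ : p.[x] * (1 + 2 * (h * b) ^+ 2) <= _); last first.
    by rewrite ler_wpM2l ?expR_ge1Dx // (horner_coef_wide _ sp) sumr_ge0.
  have -> : p.[x] * (1 + 2 * (h * b) ^+ 2) = \sum_(k < K)
      ((p`_k * x ^+ k) * (1 + 2 * (h * b) ^+ 2) + h * ((k%:R - lam) * (p`_k * x ^+ k))).
    by rewrite big_split /= -mulr_suml -mulr_sumr mean mulr0 addr0 (horner_coef_wide _ sp).
  rewrite (horner_coef_wide _ sp) mulr_sumr; apply: ler_sum => k _.
  rewrite exprMn -expRM_natl.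
  have -> : expR (- (h * lam)) * (p`_k * (x ^+ k * expR (k%:R * h)))
      = (p`_k * x ^+ k) * expR (h * (k%:R - lam)).
    rewrite [h * (_ - _)](_ : _ = - (h * lam) + k%:R * h); last by ring.
    by rewrite expRD; ring.
  have -> : (p`_k * x ^+ k) * (1 + 2 * (h * b) ^+ 2) + h * ((k%:R - lam) * (p`_k * x ^+ k))
     = (p`_k * x ^+ k) * (1 + h * (k%:R - lam) + 2 * (h * b) ^+ 2) by ring.
  apply: ler_wpM2l; first exact: p0'.
  have hk : `|h * (k%:R - lam)| <= `|h| * b.
    by rewrite normrM ler_wpM2l // kb.
  apply: le_trans (expR_le_quad _ _) _.
    by apply: le_trans (ler_norm _) _; exact: le_trans hk hb.
  rewrite lerD2l ler_pM2l // -real_normK ?num_real // -[leRHS]real_normK ?num_real //.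
  by rewrite lerXn2r ?nnegrE // (le_trans hk) // normrM (ger0_norm b0).
have : (expR (- (h * lam)) * p.[x * expR h]) ^+ n <= (p.[x] * expR (2 * (h * b) ^+ 2)) ^+ n.
  rewrite lerXn2r // nnegrE mulr_ge0 ?expR_ge0 //; last by rewrite (horner_coef_wide _ sp) sumr_ge0.
  apply: le_trans (coef_le_horner _ _ 0%N p0 _); last by rewrite mulr_ge0 ?expR_ge0 ?(ltW x0).
  by rewrite expr0 mulr1; have := p0 0%N; rewrite coef0.
rewrite exprMn [X in _ <= X]exprMn -!expRM_natl => H.
have := @coef_le_horner _ (p ^+ n) (x * expR h) m (coef_le0X _ _ p0).
rewrite mulr_ge0 ?expR_ge0 ?(ltW x0) // => /(_ isT); rewrite horner_exp exprMn -expRM_natl => H1.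
have {H1 H} := le_trans (ler_wpM2l (expR_ge0 (n%:R * - (h * lam))) H1) H.
have -> : 2 * (h * b) ^+ 2 * n%:R - h * (m%:R - lam * n%:R) =
   n%:R * (2 * (h * b) ^+ 2) - (n%:R * - (h * lam) + m%:R * h) by ring.
move: (n%:R * (2 * _)) (n%:R * - _) (m%:R * h) => A B D H.
rewrite expRD expRN [leRHS]mulrA ler_pdivlMr ?expR_gt0 // expRD.
by apply: le_trans H; rewrite le_eqVlt; apply/orP; left; apply/eqP; ring.
Qed.

(* Chernoff's bound leaves only a polynomial number of coefficients near the mean to
   share the total mass, so one of them is large. *)
Lemma coef_exp_near_mean {R : realType} (p : {poly R}) (lam x eta : R) K :
  coef_le 0 p -> (size p <= K)%N -> 0 < x -> 0 < p.[x] ->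
  \sum_(k < K) (k%:R - lam) * (p`_k * x ^+ k) = 0 -> 0 < eta ->
  exists N : nat, forall n, (N <= n)%N ->
    exists2 m : nat, `|m%:R - lam * n%:R| <= eta * n%:R &
      p.[x] ^+ n <= (K * n + 1)%:R * ((p ^+ n)`_m * x ^+ m).
Proof.
move=> p0 sp x0 px mean eta0.
pose b : R := K%:R + `|lam| + 1.
have b0 : 0 < b by rewrite ltr_wpDl // addr_ge0.
have kb k : (k < K)%N -> `|k%:R - lam| <= b.
  move=> ks; apply: le_trans (ler_normB _ _) _.
  by rewrite normr_nat /b -addrA lerD ?ler_nat ?lerDl //; lia.
(* The first bound keeps the quadratic cost below half of the gain [h * eta]; the second meets the
   condition of the Chernoff bound. *)
pose h := Num.min (eta / (4 * b ^+ 2)) (1 / (2 * b)).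
have h0 : 0 < h by rewrite lt_min !divr_gt0 ?mulr_gt0 ?exprn_gt0.
have hb : h * b <= 1 / 2.
  have : h <= 1 / (2 * b) by rewrite ge_min lexx orbT.
  rewrite ler_pdivlMr ?mulr_gt0 //; lra.
have hq : 2 * (h * b) ^+ 2 <= h * eta / 2.
  have : h <= eta / (4 * b ^+ 2) by rewrite ge_min lexx.
  rewrite ler_pdivlMr ?mulr_gt0 ?exprn_gt0 // => H.
  have := ler_wpM2l (ltW h0) H; rewrite exprMn !expr2; lra.
have [|N HN] := affine_lt_expR (h * eta / 2) K; first by rewrite !mulr_gt0.
exists N => n /HN Hn.
have Kn0 : 0 < (K * n + 1)%:R :> R by rewrite ltr0n addn1.
(* Pigeonhole: at most [K * n + 1] coefficients share the value [p.[x] ^+ n]. *)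
have [m Hm] : exists m : nat, p.[x] ^+ n <= (K * n + 1)%:R * ((p ^+ n)`_m * x ^+ m).
  apply: contrapT => nex.
  have spn : (size (p ^+ n) <= (K * n).+1)%N.
    apply: leq_trans (size_poly_exp_leq _ _) _; rewrite ltnS leq_mul2r; lia.
  have : (p ^+ n).[x] < (p ^+ n).[x].
    rewrite {1}(horner_coef_wide x spn).
    apply: lt_le_trans (_ : \sum_(i < (K * n).+1) p.[x] ^+ n / (K * n + 1)%:R <= _).
      apply: ltr_sum => [|i _]; first by apply/hasP; exists ord0; rewrite ?mem_index_enum.
      rewrite ltr_pdivlMr // mulrC real_ltNge ?num_real //; apply/negP => H.
      by apply: nex; exists i.
    by rewrite horner_exp sumr_const card_ord -[leLHS]mulr_natr addn1 mulfVK // pnatr_eq0.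
  by rewrite ltxx.
exists m => //; rewrite real_leNgt ?num_real //; apply/negP => far.
have pn : 0 < p.[x] ^+ n by rewrite exprn_gt0.
have C s : `|s| = h -> 0 <= s * (m%:R - lam * n%:R) ->
    (p ^+ n)`_m * x ^+ m <= p.[x] ^+ n * expR (- (h * eta / 2 * n%:R)).
  move=> sh sm.
  apply: le_trans (@coef_exp_le_Chernoff _ p K b lam x s m n p0 sp x0 (ltW b0) kb mean _) _.
    by rewrite sh.
  rewrite ler_wpM2l ?(ltW pn) // ler_expR.
  have -> : s * (m%:R - lam * n%:R) = h * `|m%:R - lam * n%:R|.
    by rewrite -sh -normrM ger0_norm.
  have -> : (s * b) ^+ 2 = (h * b) ^+ 2.
    by rewrite !exprMn -sh real_normK ?num_real.
  have := ler_wpM2r (ler0n R n) hq.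
  have := ler_wpM2l (ltW h0) (ltW far); lra.
have H : (p ^+ n)`_m * x ^+ m <= p.[x] ^+ n * expR (- (h * eta / 2 * n%:R)).
  have [mn|mn] := lerP 0 (m%:R - lam * n%:R).
    by apply: (C h); rewrite ?gtr0_norm // mulr_ge0 // ltW.
  by apply: (C (- h)); rewrite ?normrN ?gtr0_norm // mulNr -mulrN;
    apply: mulr_ge0; rewrite ?oppr_ge0 ltW.
have := le_trans Hm (ler_wpM2l (ltW Kn0) H).
rewrite mulrCA -[leLHS]mulr1 ler_pM2l // expRN ler_pdivlMr ?expR_gt0 // mul1r.
by rewrite real_leNgt ?num_real // Hn.
Qed.

(** * Tilting truncated weights, and the sharp exponential lower bound *)

(** The truncated weights have mean at most [lam] at [x = 1] and at least [lam] at [x = b], so some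
    [x] in between gives mean exactly [lam]. By convexity of the exponential, the mass lost through
    the tilt is at most [ln b] times the deficit of the mean, which is small. *)
Lemma tilt_truncation {R : realType} (v : nat -> R) (lam F : R) :
  weight_seq v ->
  (forall e, 0 < e -> exists K, F - e <= \sum_(k < K) v k) ->
  (forall K, \sum_(k < K) (k%:R - lam) * v k <= 0) ->
  (forall e, 0 < e -> exists b K1, 1 <= b /\ forall K, (K1 <= K)%N ->
     0 <= \sum_(k < K) (k%:R - lam) * v k * b ^+ k /\
     - (ln b * \sum_(k < K) (k%:R - lam) * v k) <= e) ->
  forall e, 0 < e -> exists K x, [/\ 1 <= x,
    \sum_(k < K) (k%:R - lam) * (v k * x ^+ k) = 0 &
    (F - e) * expR (lam * ln x) <= (wpoly v K).[x]].
Proof.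
move=> v0 HF HA HB e e0.
have e20 : 0 < e / 2 by lra.
have [K0 HK0] := HF _ e20; have [b [K1 [b1 HK1]]] := HB _ e20.
pose K := maxn K0 K1; have [Ab lbA] := HK1 K (leq_maxr _ _).
have AK := HA K.
have SK : F - e / 2 <= \sum_(k < K) v k.
  apply: le_trans HK0 _; rewrite (big_ord_widen K (fun k => v k)) ?leq_maxl //.
  by rewrite [leLHS]big_mkcond /=; apply: ler_sum => k _; case: ifP.
pose q := wpoly (fun k => (k%:R - lam) * v k) K.
have [x /andP[x1 xb] /rootP qx] : exists2 x : R, 1 <= x <= b & root q x.
  apply: poly_ivt => //; rewrite !horner_wpoly Ab andbT.
  by under eq_bigr do rewrite expr1n mulr1.
have x0 : 0 < x by lra.
exists K, x; split => //.
  by rewrite -[RHS]qx horner_wpoly; apply: eq_bigr => k _; rewrite mulrA.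
set L := ln x.
have L0 : 0 <= L by exact: ln_ge0.
have Lb : L <= ln b by rewrite ler_ln ?posrE //; lra.
have LA : - (e / 2) <= L * \sum_(k < K) (k%:R - lam) * v k.
  by apply: le_trans (_ : ln b * \sum_(k < K) (k%:R - lam) * v k <= _); [lra | exact: ler_wnM2r].
apply: le_trans (_ : (\sum_(k < K) v k + L * \sum_(k < K) (k%:R - lam) * v k)
   * expR (lam * L) <= _).
  by rewrite ler_wpM2r ?expR_ge0 //; lra.
rewrite horner_wpoly mulr_sumr -big_split mulr_suml; apply: ler_sum => k _.
(* Factoring out [expR (lam * L)] leaves [expR ((k - lam) * L)], which lies above its tangent
   [1 + (k - lam) * L]. *)
have -> : x ^+ k = expR ((k%:R - lam) * L) * expR (lam * L).
  by rewrite -expRD -[in LHS](lnK x0) -expRM_natl; congr expR; rewrite -/L; ring.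
rewrite mulrA ler_wpM2r ?expR_ge0 //=.
have := ler_wpM2l (v0 k) (expR_ge1Dx ((k%:R - lam) * L)); lra.
Qed.

(** Of the [n] parts, [n1] receive a total [m'] that carries almost the full mass of the tilted
    truncation, and the remaining [n2], a small proportion, absorb [m - m'] at merely geometric
    cost. Positivity of [Z v m n] guarantees that the residue of [m - m'] is attainable. *)
Lemma Z_lower_bound {R : realType} (v : nat -> R) (lam F : R) k0 :
  weight_seq v -> 0 < v 0%N -> 0 < lam -> lam < k0%:R -> 0 < v k0 -> 0 < F ->
  (forall e, 0 < e -> exists K x, [/\ 1 <= x,
    \sum_(k < K) (k%:R - lam) * (v k * x ^+ k) = 0 &
    (F - e) * expR (lam * ln x) <= (wpoly v K).[x]]) ->
  forall e, 0 < e -> exists d : R, 0 < d /\ exists N : nat, forall n m, (N <= n)%N ->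
    `|m%:R - lam * n%:R| <= d * n%:R -> 0 < Z v m n ->
    expR (- (e * n%:R)) * F ^+ n <= Z v m n.
Proof.
move=> v_ge0 v0 lam0 lamk vk F0 tilt e e0.
have k00 : (0 < k0)%N by rewrite -(ltr0n R) (lt_trans lam0).
have E1 : expR (- (e / 4)) < 1 by rewrite expR_lt1; lra.
have [|K [x [x1 mean GF]]] := tilt (F * (1 - expR (- (e / 4)))).
  by rewrite mulr_gt0 // subr_gt0.
have x0 : 0 < x by lra.
set p := wpoly v K in GF.
set L := ln x in GF.
have L0 : 0 <= L by exact: ln_ge0.
pose f := ln F; have Ff : F = expR f by rewrite lnK.
have {}GF : expR (f - e / 4 + lam * L) <= p.[x].
  by apply: le_trans GF; rewrite !expRD -Ff; lra.
have G0 : 0 < p.[x] := lt_le_trans (expR_gt0 _) GF.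
have p0 : coef_le 0 p by exact: wpoly_ge0.
have pmean : \sum_(k < K) (k%:R - lam) * (p`_k * x ^+ k) = 0.
  by rewrite -[RHS]mean; apply: eq_bigr => k _; rewrite coef_poly ltn_ord.
have [C [c [c0 remainder]]] := @Z_ge_geometric _ v k0 v_ge0 v0 k00 vk.
pose lc := ln c; have clc : c = expR lc by rewrite lnK.
(* [D] is so large that everything lost on the [n2 = n / D] correcting parts amounts to at most
   [e * n / 2] in the exponent. *)
have [D0 HD0] := @eventually_ge_nat R (2 / e * (`|f| + lam * L + `|lc|)).
pose D := maxn D0 2.
have D2 : (2 <= D)%N by rewrite leq_maxr.
have De : `|f| + lam * L + `|lc| <= D%:R * e / 2.
  have := ler_wpM2r (ltW e0) (HD0 D (leq_maxl _ _)).
  rewrite mulrAC divfK ?gt_eqF //; lra.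
have Dr0 : 0 < D%:R :> R by rewrite ltr0n (ltnW D2).
(* [g] is the distance from [lam] to the ends of [[0, k0]]. With [eta] as below, the deviations of
   [m] and [m'] together use at most half of the slack [g * n2]; the other half pays for
   [k0 * C]. *)
pose g := Num.min lam (k0%:R - lam).
have g0 : 0 < g by rewrite lt_min lam0 subr_gt0.
have glam : g <= lam by rewrite ge_min lexx.
have gk : g <= k0%:R - lam by rewrite ge_min lexx orbT.
pose eta := g / (8 * D%:R).
have eta0 : 0 < eta by rewrite divr_gt0 // mulr_gt0.
have etaD : eta * (8 * D%:R) = g by rewrite /eta mulfVK // gt_eqF // mulr_gt0.
exists eta; split => //.
have [N1 HN1] := @coef_exp_near_mean _ p lam x eta K p0 (size_poly _ _) x0 G0 pmean eta0.
have [N2 HN2] := @affine_lt_expR R (e / 4) K ltac:(lra).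
have [Y1 HY1] := @eventually_ge_nat R (2 * (k0%:R * C%:R) / g).
exists (D * (Y1 + C.+1) + 2 * D + 2 * N1 + N2)%N => n m nN dm Zmn.
have nn2 : (N2 <= n)%N by move: nN; clear; lia.
pose n2 := (n %/ D)%N; pose n1 := (n - n2)%N.
have n2n : (D * n2 <= n)%N by rewrite mulnC leq_trunc_div.
have n2D : (n <= 2 * (D * n2))%N.
  have := ltn_ceil n (ltnW D2 : 0 < D)%N; rewrite -/n2.
  by move: nN; move: (n2) (D) => q d; clear; nia.
have n2Y : (Y1 + C.+1 <= n2)%N by rewrite leq_divRL ?(ltnW D2) //; move: nN; move: (D) => d; clear; nia.
have n1N : (N1 <= n1)%N by rewrite /n1; move: n2n nN D2; move: (n2) (D) => q d; clear; nia.
have nE : n = (n1 + n2)%N by rewrite /n1 subnK //; move: n2n D2; move: (n2) (D) => q d; clear; nia.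
have [m' mm' Hm'] := HN1 n1 n1N.
set nn := n%:R : R in dm *; set y := n2%:R : R.
have nnE : nn = n1%:R + y by rewrite /nn nE natrD.
have y0 : 0 <= y by rewrite /y.
have n10 : 0 <= n1%:R :> R by [].
have Dy : D%:R * y <= nn by rewrite /nn /y -natrM ler_nat.
have nDy : nn <= 2 * (D%:R * y) by rewrite /nn /y -!natrM ler_nat.
have etan : 4 * (eta * nn) <= g * y.
  rewrite -etaD; have := ler_wpM2l (ltW eta0) nDy; lra.
have etan1 : eta * n1%:R <= eta * nn by rewrite ler_wpM2l ?(ltW eta0) // nnE lerDl.
have gy : 2 * (k0%:R * C%:R) <= g * y.
  have := HY1 n2 (leq_trans (leq_addr _ _) n2Y).
  by rewrite ler_pdivrMr // [n2%:R * g]mulrC.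
have [dm1 dm2] : - (eta * nn) <= m%:R - lam * nn /\ m%:R - lam * nn <= eta * nn.
  by apply/andP; rewrite -ler_norml.
have [mm1 mm2] : - (eta * n1%:R) <= m'%:R - lam * n1%:R /\ m'%:R - lam * n1%:R <= eta * n1%:R.
  by apply/andP; rewrite -ler_norml.
have lnE : lam * nn = lam * n1%:R + lam * y by rewrite nnE; ring.
have gly : g * y <= lam * y by rewrite ler_wpM2r.
have gky : g * y <= k0%:R * y - lam * y by rewrite -mulrBl ler_wpM2r.
have C0 : 0 <= C%:R :> R by [].
have kC : C%:R <= k0%:R * C%:R :> R by rewrite -natrM ler_nat leq_pmull.
have m'm : (m' <= m)%N by rewrite -(ler_nat R); nra.
have mE : m = (m' + (m - m'))%N by rewrite subnKC.
set M := (m - m')%N in mE.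
have ME : M%:R = m%:R - m'%:R :> R by rewrite /M natrB.
have pm'0 : 0 < (p ^+ n1)`_m'.
  have : 0 < (K * n1 + 1)%:R * ((p ^+ n1)`_m' * x ^+ m').
    by apply: lt_le_trans Hm'; rewrite exprn_gt0.
  by rewrite pmulr_rgt0 ?ltr0n ?addn1 // pmulr_lgt0 // exprn_gt0.
have Zm' : (p ^+ n1)`_m' <= Z v m' n1 by exact: coef_exp_le_Z.
have ZM : c ^+ n2 <= Z v M n2.
  (* Modulo [k0], subtracting [m'] is the same as adding [k0 - 1] copies of it, and that total is
     attained by joining allocations of positive weight. *)
  apply: (remainder _ _ (m + k0.-1 * m')%N (n + k0.-1 * n1)%N).
  - apply: lt_le_trans (Z_supermul _ _ _ _ _ v_ge0); rewrite mulr_gt0 //.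
    apply: lt_le_trans (Z_mul _ _ _ _ v_ge0); rewrite exprn_gt0 //.
    exact: lt_le_trans Zm'.
  - have -> : (m + k0.-1 * m' = m' * k0 + M)%N by rewrite /M; move: m'm (k00); clear; nia.
    by rewrite modnMDl.
  - by rewrite -(ler_nat R) ME; lra.
  - by rewrite -(ler_nat R) natrD !natrM ME; lra.
rewrite mE [in leRHS]nE; apply: le_trans (Z_supermul _ _ _ _ _ v_ge0).
apply: le_trans (_ : (p ^+ n1)`_m' * c ^+ n2 <= _); last first.
  by apply: ler_pM => //; [exact: ltW | rewrite exprn_ge0 // ltW].
have Kn : (K * n1 + 1)%:R <= expR (e / 4 * nn).
  by apply: le_trans (ltW (HN2 n nn2)); rewrite ler_nat nE; clear; nia.
have xm : x ^+ m' = expR (m'%:R * L) by rewrite expRM_natl lnK.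
have H1 : expR (n1%:R * (f - e / 4 + lam * L)) <= expR (e / 4 * nn) * ((p ^+ n1)`_m' * x ^+ m').
  rewrite expRM_natl; apply: le_trans (_ : p.[x] ^+ n1 <= _).
    by rewrite lerXn2r ?nnegrE ?expR_ge0 // ltW.
  apply: le_trans Hm' _; rewrite ler_wpM2r // mulr_ge0 ?ltW // exprn_gt0 //.
have H2 : expR (n1%:R * (f - e / 4 + lam * L) - e / 4 * nn - m'%:R * L) <= (p ^+ n1)`_m'.
  rewrite 2!expRD !expRN -xm ler_pdivrMr ?exprn_gt0 // ler_pdivrMr ?expR_gt0 //.
  by apply: le_trans H1 _; rewrite [leLHS]mulrC.
rewrite clc -expRM_natl -/y.
apply: le_trans (ler_wpM2r (expR_ge0 _) H2).
rewrite Ff -expRM_natl -!expRD ler_expR -/nn.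
have fy : f * y <= `|f| * y by rewrite ler_wpM2r // ler_norm.
have ly : - lc * y <= `|lc| * y by rewrite ler_wpM2r // -normrN ler_norm.
have Dy' := ler_wpM2r y0 De.
have Dy'' := ler_wpM2r (ltW e0) Dy.
have mL := ler_wpM2r L0 mm2.
have eL : eta * n1%:R * L <= lam * y * L by rewrite ler_wpM2r //; lra.
have ye : 0 <= y * e by rewrite mulr_ge0 // ltW.
rewrite nnE in Dy'' *; lra.
Qed.

(** * The mean number of vanishing parts when [tau > 0] *)

Lemma coef_le0Z {R : realType} (c : R) (p : {poly R}) :
  0 <= c -> coef_le 0 p -> coef_le 0 (c *: p).
Proof.
by move=> c0 p0 i; rewrite coef0 coefZ mulr_ge0 //; have := p0 i; rewrite coef0.
Qed.

(* Jensen's inequality for [j |-> expR (h * j)] under the law of the number [j] of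
   factors [B] chosen when expanding [(Q + B) ^+ n.+1]. *)
Lemma tilted_coef_ge {R : realType} (Q B : {poly R}) (h : R) m n :
  coef_le 0 Q -> coef_le 0 B -> 0 < ((Q + B) ^+ n.+1)`_m ->
  expR (h * (n.+1%:R * ((B * (Q + B) ^+ n)`_m / ((Q + B) ^+ n.+1)`_m)))
    * ((Q + B) ^+ n.+1)`_m <= ((Q + expR h *: B) ^+ n.+1)`_m.
Proof.
move=> Q0 B0 T0; set T := ((Q + B) ^+ n.+1)`_m in T0 *.
pose p j := (Q ^+ (n.+1 - j) * B ^+ j)`_m * 'C(n.+1, j)%:R.
have p0 j : 0 <= p j.
  have := coef_le0M _ _ (coef_le0X _ (n.+1 - j) Q0) (coef_le0X _ j B0) m.
  by rewrite coef0 => ?; rewrite mulr_ge0.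
have TE : T = \sum_(j < n.+2) p j.
  by rewrite /T exprDn coef_sum; apply: eq_bigr => j _; rewrite coefMn -mulr_natr.
have RE : ((Q + expR h *: B) ^+ n.+1)`_m = \sum_(j < n.+2) p j * expR (j%:R * h).
  rewrite exprDn coef_sum; apply: eq_bigr => j _.
  by rewrite coefMn -[LHS]mulr_natr exprZn -scalerAr coefZ expRM_natl /p; ring.
(* The absorption identity for binomial coefficients identifies [n + 1] times the marked-factor
   coefficient with the first moment of [j]. *)
have ME : n.+1%:R * (B * (Q + B) ^+ n)`_m = \sum_(j < n.+2) j%:R * p j.
  rewrite [RHS]big_ord_recl mul0r add0r exprDn mulr_sumr coef_sum mulr_sumr.
  apply: eq_bigr => j _; rewrite lift0 /p subSS mulrCA -natrM -mul_bin_diag natrM.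
  by rewrite [B * _]mulrnAr coefMn -[X in _ * X]mulr_natr exprS [B * (Q ^+ _ * _)]mulrCA; ring.
set mu := n.+1%:R * _.
have muT : mu * T = \sum_(j < n.+2) j%:R * p j.
  by rewrite -ME /mu mulrA divfK // gt_eqF.
(* The exponential is replaced by its tangent at the mean [mu], whose linear part averages to
   zero. *)
rewrite RE; apply: le_trans (_ : \sum_(j < n.+2)
    expR (h * mu) * (p j + h * (j%:R * p j) - h * mu * p j) <= _).
  rewrite -mulr_sumr sumrB big_split /= -!mulr_sumr -muT -TE.
  by rewrite le_eqVlt; apply/orP; left; apply/eqP; ring.
apply: ler_sum => j _.
have -> : j%:R * h = h * mu + h * (j%:R - mu) by ring.
rewrite expRD [leRHS]mulrCA ler_wpM2l ?expR_ge0 //.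
have := ler_wpM2l (p0 j) (expR_ge1Dx (h * (j%:R - mu))); lra.
Qed.

(** The first ratio is the probability that a given one of [n + 1] parts vanishes. Uniformity over a
    window of totals [m] around [lam * (n + 1)] keeps the sequence [m(n)] out of the estimates. *)
Definition zero_part_cvg {R : realType} (w : nat -> R) (lam F : R) :=
  forall e : R, 0 < e -> exists d : R, 0 < d /\ exists N : nat, forall n m, (N <= n)%N ->
    `|m%:R - lam * n.+1%:R| <= d * n.+1%:R -> 0 < Z w m n.+1 ->
    `|w 0%N * Z w m n / Z w m n.+1 - w 0%N / F| <= e.

(** Jensen's inequality, the bound [(F + (expR s - 1) * v 0) ^+ n.+1] on the tilted sum and the
    lower bound on [Z] give [s * pi <= h ^+ 2 + (expR s - 1) * pi0]. Taking [s = h] and [s = - h]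
    confines [pi - pi0] to [[- 3 * h, 3 * h]]. *)
Lemma zero_part_cvg_tilted {R : realType} (v : nat -> R) (lam F : R) :
  weight_seq v -> 0 < F -> (forall K, \sum_(k < K) v k <= F) ->
  (forall e, 0 < e -> exists d : R, 0 < d /\ exists N : nat, forall n m, (N <= n)%N ->
    `|m%:R - lam * n%:R| <= d * n%:R -> 0 < Z v m n ->
    expR (- (e * n%:R)) * F ^+ n <= Z v m n) ->
  zero_part_cvg v lam F.
Proof.
move=> v_ge0 F0 vF lower e e0.
pose h := Num.min (1 / 2) (e / 3).
have h0 : 0 < h by rewrite lt_min; apply/andP; split; lra.
have h2 : h <= 1 / 2 by rewrite ge_min lexx.
have he : 3 * h <= e by have : h <= e / 3; [rewrite ge_min lexx orbT | lra].
(* The exponential error is [h ^+ 2], so that it is still of order [h] after division by [s]. *)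
have [d [d0 [N HN]]] := lower (h ^+ 2) (exprn_gt0 _ h0).
exists d; split => //; exists N => n m Nn dm Z0.
have {HN} low := HN n.+1 m (leqW Nn) dm Z0.
pose P := wpoly v m.+1; pose B := (v 0%N)%:P; pose Q := P - B.
have QB : Q + B = P by rewrite subrK.
have P0 : coef_le 0 P by exact: wpoly_ge0.
have B0 : coef_le 0 B by move=> i; rewrite coef0 coefC; case: eqP.
have Q0 : coef_le 0 Q.
  move=> [|i]; rewrite coef0 coefB coefC ?coef_poly /= ?subrr // subr0.
  by case: ifP.
have ZE : Z v m n.+1 = (P ^+ n.+1)`_m by rewrite (@Z_coef _ _ _ _ m.+1).
have ZE' : v 0%N * Z v m n = (B * P ^+ n)`_m by rewrite coefCM (@Z_coef _ _ _ _ m.+1).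
set pi := _ / Z v m n.+1; set pi0 := _ / F.
have v0F : v 0%N <= F by have := vF 1%N; rewrite big_ord1.
have pi01 : pi0 <= 1 by rewrite ler_pdivrMr // mul1r.
have pi00 : 0 <= pi0 by rewrite divr_ge0 // ltW.
have key s : s <= 1 / 2 -> s * pi <= h ^+ 2 + (s + 2 * s ^+ 2) * pi0.
  move=> s2; have := @tilted_coef_ge _ Q B s m n Q0 B0.
  rewrite QB -ZE -ZE' => /(_ Z0) H.
  have QsB0 : coef_le 0 (Q + expR s *: B).
    by rewrite -[0]addr0; apply: coef_leD => //; apply: coef_le0Z => //; exact: expR_ge0.
  have := @coef_le_horner _ ((Q + expR s *: B) ^+ n.+1) 1 m (coef_le0X _ _ QsB0) ler01.
  rewrite expr1n mulr1 horner_exp hornerD hornerZ hornerD hornerN hornerC => H1.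
  have P1 : P.[1] <= F.
    by rewrite horner_wpoly; under eq_bigr do rewrite expr1n mulr1; exact: vF.
  have vP : v 0%N <= P.[1].
    rewrite horner_wpoly (bigD1 ord0) //= expr0 mulr1 lerDl sumr_ge0 // => k _.
    by rewrite expr1n mulr1.
  have H2 : (P.[1] - v 0%N + expR s * v 0%N) ^+ n.+1
      <= F ^+ n.+1 * expR (n.+1%:R * ((expR s - 1) * pi0)).
    rewrite expRM_natl -exprMn; apply: lerXn2r; rewrite ?nnegrE.
    - by rewrite addr_ge0 ?subr_ge0 // mulr_ge0 ?expR_ge0.
    - by rewrite mulr_ge0 ?expR_ge0 // ltW.
    apply: le_trans (_ : F * (1 + (expR s - 1) * pi0) <= _).
      have -> : F * (1 + (expR s - 1) * pi0) = F + (expR s - 1) * v 0%N.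
        by rewrite /pi0; field; rewrite gt_eqF.
      lra.
    by rewrite ler_wpM2l ?expR_ge1Dx // ltW.
  have Fn0 : 0 < F ^+ n.+1 by rewrite exprn_gt0.
  have H3 := le_trans H (le_trans H1 H2).
  have {H H1 H2} H3 := le_trans (ler_wpM2l (expR_ge0 _) low) H3.
  rewrite -/pi [leLHS]mulrA [leLHS]mulrC ler_pM2l // -expRD ler_expR in H3.
  have n0 : 0 < n.+1%:R :> R by rewrite ltr0n.
  rewrite -(ler_pM2l n0).
  have := ler_wpM2r pi00 (expR_le_quad s s2) => H4.
  have := ler_wpM2l (ltW n0) H4; lra.
have k1 := key h h2; have k2 := key (- h) ltac:(lra).
have hpi : h * pi0 <= h by rewrite ger_pMr.
rewrite ler_norml; apply/andP; split.
  rewrite -(ler_pM2l h0); move: k2; rewrite sqrrN !expr2 => k2.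
  have := ler_wpM2l (ltW h0) hpi; have := ler_wpM2l (ltW h0) he; lra.
rewrite -(ler_pM2l h0); move: k1; rewrite !expr2 => k1.
have := ler_wpM2l (ltW h0) hpi; have := ler_wpM2l (ltW h0) he; lra.
Qed.

(** * The degenerate case [tau = 0] *)

(* Replacing [k] parts equal to [a] by [a] parts equal to [k] and [k - a] zeros keeps
   the sum, so a very large [w k] makes parts equal to [a] rare. *)
Lemma part_rare {R : realType} (w : nat -> R) a :
  weight_seq w -> 0 < w 0%N -> (0 < a)%N ->
  (forall T : R, 0 < T -> exists2 k : nat, (a <= k)%N & T ^+ k <= w k) ->
  forall e, 0 < e -> exists N : nat, forall n m, (N <= n)%N -> (a <= m)%N ->
    0 < Z w m n.+1 -> w a * Z w (m - a) n / Z w m n.+1 <= e.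
Proof.
move=> w_ge0 w0 a0 heavy e e0.
pose kp := Num.min 1 (e / 4).
have kp0 : 0 < kp by rewrite lt_min ltr01 divr_gt0.
have kp1 : kp <= 1 by rewrite ge_min lexx.
have kpe : kp <= e / 4 by rewrite ge_min lexx orbT.
pose w1 := Num.min 1 (w 0%N).
have w10 : 0 < w1 by rewrite lt_min ltr01.
have w11 : w1 <= 1 by rewrite ge_min lexx.
have w1w : w1 <= w 0%N by rewrite ge_min lexx orbT.
(* This [T] makes [w k] heavy enough to absorb [w a ^+ k], the weights of the zeros and the gain
   [kp ^+ k]. *)
pose T := Num.max 1 (w a / (kp * w1)).
have T1 : 1 <= T by rewrite le_max lexx.
have Tw : w a <= T * (kp * w1).
  by rewrite -ler_pdivrMr ?mulr_gt0 // le_max lexx orbT.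
have [k ak wk] := heavy T (lt_le_trans ltr01 T1).
have k0 : (0 < k)%N by exact: leq_trans ak.
have Zk : (w a) ^+ k <= kp ^+ k * Z w (a * k) k.
  have kE : k = (a * 1 + (k - a) * 1)%N by rewrite !muln1 subnKC.
  have -> : Z w (a * k) k = Z w (a * k + (k - a) * 0) (a * 1 + (k - a) * 1).
    by rewrite -kE muln0 addn0.
  apply: le_trans (_ : kp ^+ k * (w k ^+ a * w 0%N ^+ (k - a)) <= _); last first.
    rewrite ler_wpM2l ?exprn_ge0 ?(ltW kp0) //.
    apply: le_trans (Z_supermul _ _ _ _ _ w_ge0).
    rewrite -[w k](Z1 w) -[w 0%N](Z1 w).
    by apply: ler_pM; rewrite ?exprn_ge0 ?Z_ge0 //; exact: Z_mul.
  apply: le_trans (_ : (T * (kp * w1)) ^+ k <= _).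
    by rewrite lerXn2r ?nnegrE // !mulr_ge0 ?(ltW kp0) ?(ltW w10) // (le_trans ler01).
  rewrite exprMn mulrC exprMn -mulrA ler_wpM2l ?exprn_ge0 ?(ltW kp0) // mulrC.
  apply: ler_pM; rewrite ?exprn_ge0 ?(ltW w10) ?(le_trans ler01) //.
    apply: le_trans (_ : (T ^+ k) ^+ a <= _); last first.
      by rewrite lerXn2r ?nnegrE ?exprn_ge0 // (le_trans ler01).
    by rewrite -exprM; apply: ler_weXn2l => //; rewrite leq_pmulr.
  apply: le_trans (_ : w1 ^+ (k - a) <= _).
    by apply: ler_wiXn2l; rewrite ?(ltW w10) // leq_subr.
  by rewrite lerXn2r ?nnegrE // (ltW w10).
pose c := - ln (kp ^+ k).
have kpk0 : 0 < kp ^+ k by rewrite exprn_gt0.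
have [N HN] := @eventually_ge_nat R (4 * c / e).
exists N => n m Nn am Z0.
pose P := wpoly w (m + a * k).+1; pose B := w a *: 'X^a; pose Q := P - B.
have QB : Q + B = P by rewrite subrK.
have P0 : coef_le 0 P by exact: wpoly_ge0.
have B0 : coef_le 0 B.
  by move=> i; rewrite coef0 coefZ coefXn mulr_ge0.
have BP : coef_le B P.
  move=> i; rewrite coefZ coefXn coef_poly; have [->|_] := eqVneq i a.
    rewrite mulr1 (_ : (a < (m + a * k).+1)%N) // ltnS.
    by rewrite (leq_trans am) // leq_addr.
  by rewrite mulr0; case: ifP.
have Q0 : coef_le 0 Q by move=> i; rewrite coef0 coefB subr_ge0.
have ZE : Z w m n.+1 = (P ^+ n.+1)`_m.
  by rewrite (@Z_coef _ _ _ _ (m + a * k).+1) // ltnS leq_addr.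
have ZE' : w a * Z w (m - a) n = (B * P ^+ n)`_m.
  rewrite -scalerAl coefZ coefXnM ltnNge am /= (@Z_coef _ _ _ _ (m + a * k).+1) //.
  by rewrite ltnS (leq_trans (leq_subr _ _)) // leq_addr.
have kP0 : coef_le 0 (kp *: P) by apply: coef_le0Z => //; exact: ltW.
have BkP : coef_le (B ^+ k) ((kp *: P) ^+ k).
  move=> i; rewrite exprZn -exprM coefZ coefXn exprZn coefZ.
  have [->|_] := eqVneq i (a * k)%N.
    by rewrite mulr1 -(@Z_coef _ _ _ _ (m + a * k).+1) // ltnS leq_addl.
  by rewrite mulr0 mulr_ge0 ?(ltW kpk0) //; have := coef_le0X _ k P0 i; rewrite coef0.
(* The [j] marked factors are traded in groups of [k]; the fewer than [k] left over cost only the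
   constant [kp ^+ k]. *)
have BjP j : coef_le (kp ^+ k *: B ^+ j) ((kp *: P) ^+ j).
  rewrite [in B ^+ j](divn_eq j k) [in X in coef_le _ X](divn_eq j k).
  rewrite !exprD ![((_ %/ _) * k)%N]mulnC !exprM scalerAr; apply: coef_leM.
  - exact/coef_le0X/coef_le0X.
  - by apply: coef_le0Z; [exact: ltW | exact: coef_le0X].
  - by apply: coef_leX => //; exact: coef_le0X.
  move=> i; rewrite [(kp *: P) ^+ _]exprZn !coefZ; apply: ler_pM; rewrite ?(ltW kpk0) //.
  - by have := coef_le0X _ (j %% k) B0 i; rewrite coef0.
  - by apply: ler_wiXn2l; rewrite ?(ltW kp0) // ltnW // ltn_pmod.
  exact: coef_leX.
have PB : kp ^+ k * ((P + B) ^+ n.+1)`_m <= expR (kp * n.+1%:R) * Z w m n.+1.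
  apply: le_trans (_ : ((P + kp *: P) ^+ n.+1)`_m <= _).
    rewrite !exprDn !coef_sum mulr_sumr; apply: ler_sum => j _.
    rewrite !coefMn [kp ^+ k * _]mulrnAr lerMn2r; apply/orP; right.
    rewrite -coefZ scalerAr; apply: coef_leM => //.
    + exact: coef_le0X.
    + by apply: coef_le0Z; [exact: ltW | exact: coef_le0X].
  rewrite -{1}[P]scale1r -scalerDl exprZn coefZ -ZE ler_wpM2r ?Z_ge0 //.
  rewrite mulrC expRM_natl lerXn2r ?nnegrE ?expR_ge0 ?expR_ge1Dx // addr_ge0 //.
  exact: ltW.
(* Tilting by [ln 2] doubles the weight of parts equal to [a], which turns [P] into [P + B]. *)
have := @tilted_coef_ge _ Q B (ln 2) m n Q0 B0.
rewrite QB -ZE -ZE' lnK ?posrE // => /(_ Z0).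
have -> : Q + 2 *: B = P + B by rewrite scaler_nat mulr2n addrA QB.
set pi := _ / Z w m n.+1 => H.
have {H PB} := le_trans (ler_wpM2l (ltW kpk0) H) PB.
rewrite mulrA ler_pM2r // -[kp ^+ k](@lnK R) ?posrE // -expRD ler_expR => H.
have ln2 : 1 / 2 <= ln 2 :> R.
  rewrite -[leLHS]expRK ler_ln ?posrE ?expR_gt0 //.
  by apply: le_trans (expR_le_quad _ (lexx _)) _; rewrite expr2; lra.
have pi0 : 0 <= pi by rewrite divr_ge0 ?mulr_ge0 ?Z_ge0.
have cn : 4 * c <= e * n.+1%:R.
  have := HN n.+1 (leqW Nn); rewrite ler_pdivrMr //; lra.
have n0 : 0 < n.+1%:R :> R by rewrite ltr0n.
have npi : 0 <= n.+1%:R * pi by rewrite mulr_ge0.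
have := ler_wpM2r npi ln2.
have := ler_wpM2r (ltW n0) kpe.
rewrite /c in cn => H1 H2; rewrite -(ler_pM2l n0); lra.
Qed.

(* Markov's inequality controls the parts larger than [L]. *)
Lemma zero_part_ge {R : realType} (w : nat -> R) m n L : weight_seq w ->
  Z w m n.+1 - w 0%N * Z w m n
    <= \sum_(a < L.+1 | (0 < a <= m)%N) w a * Z w (m - a) n
       + m%:R / (n.+1%:R * L.+1%:R) * Z w m n.+1.
Proof.
move=> w0; have n0 : n.+1%:R != 0 :> R by rewrite pnatr_eq0.
have L0 : 0 < L.+1%:R :> R by rewrite ltr0n.
(* By [Z_mean] the Markov term is a sum over all part sizes, with factor at least [1] on those above
   [L]. *)
have -> : m%:R / (n.+1%:R * L.+1%:R) * Z w m n.+1 =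
    \sum_(a < m.+1) a%:R / L.+1%:R * (w a * Z w (m - a) n).
  apply: (mulfI n0); rewrite (_ : n.+1%:R * _ = m%:R * Z w m n.+1 / L.+1%:R); last first.
    by move: (n.+1%:R : R) (L.+1%:R : R) n0 L0 => x y x0 y0; field; rewrite x0 gt_eqF.
  rewrite -Z_mean -mulrA mulr_suml; congr (_ * _); apply: eq_bigr => a _.
  by rewrite mulrAC.
pose u a := w a * Z w (m - a) n.
have u0 a : 0 <= u a by rewrite mulr_ge0 ?Z_ge0.
have -> : Z w m n.+1 - w 0%N * Z w m n = \sum_(a < m.+1 | (0 < a)%N) u a.
  rewrite Z_recl (bigD1 ord0) //= subn0 addrAC subrr add0r.
  by apply: eq_bigl => a; rewrite lt0n.
have -> : \sum_(a < L.+1 | (0 < a <= m)%N) w a * Z w (m - a) n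
    = \sum_(a < m.+1 | (0 < a)%N && (a <= L)%N) u a.
  transitivity (\sum_(a < (m + L).+1 | (0 < a <= m)%N && (a < L.+1)%N) u a).
    by apply: (@big_ord_widen_cond _ _ _ _ _ (fun a => 0 < a <= m)%N u); rewrite ltnS leq_addl.
  transitivity (\sum_(a < (m + L).+1 | (0 < a)%N && (a <= L)%N && (a < m.+1)%N) u a).
    by apply: eq_bigl => a; rewrite !ltnS andbAC.
  apply/esym/(@big_ord_widen_cond _ _ _ _ _ (fun a => (0 < a)%N && (a <= L)%N) u).
  by rewrite ltnS leq_addr.
rewrite big_mkcond [X in _ <= X + _]big_mkcond -big_split /=; apply: ler_sum => a _.
have [a0|_] := posnP a; first by rewrite a0 mul0r mul0r add0r.
rewrite -/(u a) /=; case: leqP => aL; first by rewrite lerDl mulr_ge0 ?divr_ge0.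
by rewrite add0r ler_peMl // ler_pdivlMr // mul1r ler_nat.
Qed.

(** Here the limit is [1], so nonzero parts must be rare. Those above [L] are handled by Markov's
    inequality, those from [1] to [L] by [part_rare]; for [lam = 0] the choice [L = 0] leaves only
    the Markov term. *)
Lemma zero_part_cvg_degenerate {R : realType} (w : nat -> R) (lam : R) :
  weight_seq w -> 0 < w 0%N -> 0 <= lam ->
  (0 < lam -> forall a, forall T : R, 0 < T ->
     exists2 k : nat, (a <= k)%N & T ^+ k <= w k) ->
  zero_part_cvg w lam (w 0%N).
Proof.
move=> w_ge0 w0 lam0 heavy e e0.
suff [d [L [N [d0 H]]]] : exists (d : R) (L N : nat), 0 < d /\ forall n m, (N <= n)%N ->
    `|m%:R - lam * n.+1%:R| <= d * n.+1%:R -> 0 < Z w m n.+1 ->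
    \sum_(a < L.+1 | (0 < a <= m)%N) w a * Z w (m - a) n
      <= e / 2 * Z w m n.+1 /\ (lam + d) / L.+1%:R <= e / 2.
  exists d; split => //; exists N => n m Nn dm Z0.
  have [H1 H2] := H n m Nn dm Z0.
  rewrite divff ?gt_eqF // distrC ger0_norm; last first.
    rewrite subr_ge0 ler_pdivrMr // mul1r Z_recl big_ord_recl subn0 lerDl sumr_ge0 // => a _.
    by rewrite mulr_ge0 ?Z_ge0.
  rewrite -(ler_pM2r Z0) mulrBl divfK ?gt_eqF // mul1r.
  apply: le_trans (zero_part_ge _ _ _ L w_ge0) _.
  have n0 : 0 < n.+1%:R :> R by rewrite ltr0n.
  have L0 : 0 < L.+1%:R :> R by rewrite ltr0n.
  have : m%:R / (n.+1%:R * L.+1%:R) <= e / 2.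
    apply: le_trans H2; rewrite invfM mulrA ler_pM2r ?invr_gt0 // ler_pdivrMr //.
    by move: dm; rewrite ler_norml => /andP[_]; rewrite lerBlDl -mulrDl.
  move: (m%:R / _) => r /(ler_wpM2r (ltW Z0)); lra.
have [lam_gt0|lamN] := ltrP 0 lam; last first.
  have {lamN}-> : lam = 0 by apply/le_anti; rewrite lamN.
  exists (e / 2), 0%N, 0%N; split => [|n m _ _ Z0]; first by lra.
  split; last by rewrite add0r divr1.
  rewrite big1 ?mulr_ge0 ?(ltW Z0) //; first by lra.
  by case=> [[|a]].
have [L HL] := @eventually_ge_nat R (2 * (lam + 1) / e).
have L0 : 0 < L.+1%:R :> R by rewrite ltr0n.
have e1 : 0 < e / (2 * L.+1%:R) by rewrite divr_gt0 ?mulr_gt0.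
have /boolp.choice[f Hf] : forall a, exists N : nat, (0 < a)%N -> forall n m,
    (N <= n)%N -> (a <= m)%N -> 0 < Z w m n.+1 ->
    w a * Z w (m - a) n / Z w m n.+1 <= e / (2 * L.+1%:R).
  move=> a; have [->|a0] := posnP a; first by exists 0%N.
  by have [N HN] := part_rare w a w_ge0 w0 a0 (heavy lam_gt0 a) _ e1; exists N.
exists 1, L, (\max_(a < L.+1) f a)%N; split => // n m Nn dm Z0; split; last first.
  have := HL L.+1 (leqnSn L); rewrite !ler_pdivrMr //; lra.
apply: le_trans (_ : \sum_(a < L.+1 | (0 < a <= m)%N) (e / (2 * L.+1%:R) * Z w m n.+1) <= _).
  apply: ler_sum => a /andP[a0 am]; rewrite -ler_pdivrMr //; apply: Hf => //.
  exact: leq_trans (@leq_bigmax _ (fun i : 'I_L.+1 => f i) a) Nn.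
rewrite -mulr_suml ler_wpM2r ?(ltW Z0) //.
apply: le_trans (_ : \sum_(a < L.+1) (e / (2 * L.+1%:R)) <= _).
  by rewrite [leLHS]big_mkcond; apply: ler_sum => a _; case: ifP => // _; exact: ltW.
rewrite sumr_const card_ord -[leLHS]mulr_natr le_eqVlt; apply/orP; left; apply/eqP.
by move: (L.+1%:R : R) L0 => y y0; field; rewrite gt_eqF.
Qed.

(** * Partial sums and nonnegative series *)

Lemma ler_psum_widen {R : realType} (u : nat -> R) K K' : (K <= K')%N ->
  (forall k, (K <= k)%N -> 0 <= u k) -> \sum_(k < K) u k <= \sum_(k < K') u k.
Proof.
move=> /subnKC <- u0; elim: (K' - K)%N => [|i ih]; first by rewrite addn0.
by rewrite addnS big_ord_recr /=; apply: (le_trans ih); rewrite lerDl u0 // leq_addr.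
Qed.

Lemma psum_truncate {R : realType} (u : nat -> R) L K : (L <= K)%N ->
  \sum_(k < K) (if (k < L)%N then u k else 0) = \sum_(k < L) u k.
Proof. by move=> LK; rewrite (big_ord_widen K u LK) [RHS]big_mkcond. Qed.

Lemma psum_le_nneseries {R : realType} (u : nat -> R) K : (forall k, 0 <= u k) ->
  ((\sum_(k < K) u k)%:E <= \sum_(0 <= k <oo) (u k)%:E)%E.
Proof.
move=> u0; rewrite -(big_mkord predT) -sumEFin; apply: nneseries_lim_ge => n _ _.
by rewrite lee_fin.
Qed.

Lemma nneseries_le_psum {R : realType} (u : nat -> R) (r : R) : (forall k, 0 <= u k) ->
  (forall K, \sum_(k < K) u k <= r) -> (\sum_(0 <= k <oo) (u k)%:E <= r%:E)%E.
Proof.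
move=> u0 ur; apply: lime_le.
  by apply: is_cvg_nneseries => n _ _; rewrite lee_fin.
by apply: nearW => K; rewrite sumEFin lee_fin big_mkord.
Qed.

(** * From vanishing parts to the ratio of allocation sums *)

Lemma Z_ratio_cvg {R : realType} (w : nat -> R) (m : nat -> nat) (lam F : R) :
  weight_seq w -> 0 < w 0%N -> 0 < F ->
  (fun n : nat => (m n)%:R / n%:R) @ \oo --> lam -> zero_part_cvg w lam F ->
  (fun n : nat => (Z w (m n) n.+1 / Z w (m n) n)%:E)
     @ within [set n : nat | 0 < Z w (m n) n] \oo --> F%:E.
Proof.
move=> w_ge0 w0 F0 mlam zp.
(* Appending a zero part preserves positivity. *)
have Zpos n : 0 < Z w (m n) n -> 0 < Z w (m n) n.+1.
  move=> Zn; have := Z_supermul w (m n) n 0 1 w_ge0; rewrite addn0 addn1 Z1.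
  by apply: lt_le_trans; rewrite mulr_gt0.
have q_cvg : w 0%N * Z w (m n) n / Z w (m n) n.+1
    @[n --> within [set n : nat | 0 < Z w (m n) n] \oo] --> w 0%N / F.
  apply/cvgrPdist_le => e e0.
  have [d [d0 [N HN]]] := zp e e0.
  have d20 : 0 < d / 2 by lra.
  have /cvgrPdist_le/(_ _ d20)[N1 _ HN1] := mlam.
  have [N2 HN2] := @eventually_ge_nat R (2 * `|lam| / d).
  rewrite near_withinE; exists (N + N1 + N2 + 1)%N => // n /= nN Zn.
  rewrite distrC; apply: HN; [by move: nN; clear; lia| |exact: Zpos].
  have n0 : 0 < n%:R :> R by rewrite ltr0n; move: nN; clear; lia.
  have /= := HN1 n ltac:(move: nN; clear; rewrite /=; lia).
  have := HN2 n ltac:(move: nN; clear; lia); rewrite ler_pdivrMr // => H2 H1.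
  have {H1} : `|(m n)%:R - lam * n%:R| <= d / 2 * n%:R.
    rewrite distrC (_ : _ - _ = (lam - (m n)%:R / n%:R) * n%:R).
      by rewrite normrM (ger0_norm (ltW n0)) ler_wpM2r // ltW.
    by rewrite mulrBl divfK ?gt_eqF.
  (* The window is centred at [lam * (n + 1)]; the shift by [lam] fits into the spare [d / 2 * n]
     for large [n]. *)
  move=> H1; have -> : (m n)%:R - lam * n.+1%:R = (m n)%:R - lam * n%:R - lam.
    by rewrite -natr1; ring.
  apply: le_trans (ler_normB _ _) _; rewrite -natr1; lra.
apply: cvg_EFin; first exact: nearW.
rewrite /comp /=.
have FE : F = w 0%N * (w 0%N / F)^-1 by field; rewrite !gt_eqF.
rewrite [X in _ --> X]FE.
have : w 0%N * (w 0%N * Z w (m n) n / Z w (m n) n.+1)^-1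
    @[n --> within [set n : nat | 0 < Z w (m n) n] \oo] --> w 0%N * (w 0%N / F)^-1.
  by apply: cvgMl_tmp; apply: cvgV => //; rewrite gt_eqF // divr_gt0.
apply: cvg_trans; apply: near_eq_cvg; rewrite near_withinE; apply: nearW => n /= Zn.
have Zn1 := Zpos n Zn.
by field; rewrite !gt_eqF.
Qed.

Lemma zero_part_cvg_scale {R : realType} (w : nat -> R) (t lam F : R) : 0 < t ->
  zero_part_cvg (fun k => w k * t ^+ k) lam F -> zero_part_cvg w lam F.
Proof.
move=> t0 zp e e0; have [d [d0 [N HN]]] := zp e e0.
exists d; split => //; exists N => n m Nn dm Z0.
have tm : 0 < t ^+ m by rewrite exprn_gt0.
have := HN n m Nn dm; rewrite !Z_scale expr0 mulr1 => /(_ (mulr_gt0 tm Z0)).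
rewrite (_ : w 0%N * (t ^+ m * Z w m n) / _ = w 0%N * Z w m n / Z w m n.+1) //.
by field; rewrite !gt_eqF.
Qed.

(** * The generating function at and near its radius of convergence *)

Section ExtendedReals.
Context {R : realType} (w : nat -> R).
Hypotheses (w_ge0 : weight_seq w) (w0 : 0 < w 0%N).

Lemma weight_term_ge0 t : 0 <= t -> forall k, 0 <= w k * t ^+ k.
Proof. by move=> t0 k; rewrite mulr_ge0 ?exprn_ge0. Qed.

Lemma mean_term_ge0 t : 0 <= t -> forall k, 0 <= k%:R * w k * t ^+ k.
Proof. by move=> t0 k; rewrite mulr_ge0 ?exprn_ge0 ?mulr_ge0. Qed.

Lemma Phi_gt0 t : 0 <= t -> (0 < Phi w t)%E.
Proof.
move=> t0; apply: lt_le_trans (psum_le_nneseries _ 1 (weight_term_ge0 _ t0)).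
by rewrite lte_fin big_ord1 expr0 mulr1.
Qed.

Lemma Phi_le s t : 0 <= s -> s <= t -> (Phi w s <= Phi w t)%E.
Proof.
move=> s0 st; apply: lee_nneseries => k _.
  by rewrite lee_fin weight_term_ge0.
by rewrite lee_fin ler_wpM2l // lerXn2r // nnegrE // (le_trans s0).
Qed.

Lemma Phi0_lty : (Phi w 0 < +oo)%E.
Proof.
apply: le_lt_trans (ltry (w 0%N)); apply: nneseries_le_psum.
  exact: weight_term_ge0.
case=> [|K]; first by rewrite big_ord0 ltW.
by rewrite big_ord_recl expr0 mulr1 big1 ?addr0 // => i _; rewrite exprS mul0r mulr0.
Qed.

Lemma Phi_lt_rho t : 0 <= t -> (t%:E < rho_w w)%E -> (Phi w t < +oo)%E.
Proof.
move=> t0 /ereal_sup_gt[_ [s [s0 Phis] <-]]; rewrite lte_fin => ts.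
by apply: le_lt_trans Phis; rewrite Phi_le // ltW.
Qed.

Lemma psum_unbounded t B : 0 <= t -> ~~ (Phi w t < +oo)%E ->
  exists K, B < \sum_(k < K) w k * t ^+ k.
Proof.
move=> t0 Phit; apply: contrapT => nK; move/negP: Phit; apply.
apply: le_lt_trans (ltry B); apply: nneseries_le_psum; first exact: weight_term_ge0.
by move=> K; rewrite leNgt; apply/negP => BK; apply: nK; exists K.
Qed.

Lemma Phi_gt_rho t : 0 <= t -> (rho_w w < t%:E)%E -> ~~ (Phi w t < +oo)%E.
Proof.
move=> t0 rt; apply/negP => Pt; move: rt; apply/negP; rewrite -leNgt.
by apply: ereal_sup_ubound; exists t.
Qed.

(** Divergence at [tau <= rho] forces [tau = rho]. As [t] increases to [tau], [Phi t] outgrows twice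
    the bounded contribution [W] of the indices below [L], so at least half of the mass sits at
    indices [k >= L] and [Psi t] is at least about [L / 2], with [L] arbitrary. *)
Lemma nu_pinfty tau : 0 <= tau -> (tau%:E <= rho_w w)%E ->
  ~~ (Phi w tau < +oo)%E -> nu_w w = +oo%E.
Proof.
move=> tau0 tr Pt.
have rE : rho_w w = tau%:E.
  apply/le_anti; rewrite tr andbT; apply: ge_ereal_sup => _ [s [s0 Ps] <-].
  rewrite lee_fin leNgt; apply/negP => ts; move/negP: Pt; apply.
  by apply: le_lt_trans Ps; rewrite Phi_le // ltW.
have taup : 0 < tau.
  rewrite lt_neqAle tau0 andbT; apply/eqP => t0.
  by move/negP: Pt; apply; rewrite -t0 Phi0_lty.
rewrite /nu_w rE (negbTE Pt); apply: cvg_lim; first exact: ereal_hausdorff.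
apply/cvgeyPge => A.
have [L HL] := @eventually_ge_nat R (2 * (`|A| + 1)).
pose A1 := `|A| + 1.
have A10 : 0 < A1 by rewrite ltr_wpDl.
have AA1 : A <= A1 by rewrite (le_trans (ler_norm A)) // lerDl.
pose W := \sum_(k < L) w k * tau ^+ k.
have [K HK] := psum_unbounded _ (2 * W) tau0 Pt.
have near_large : \forall t \near tau^'-, 2 * W < (wpoly w K).[t].
  have c : (wpoly w K).[t] @[t --> tau^'-] --> (wpoly w K).[tau].
    by apply: cvg_at_left_filter; exact: continuous_horner.
  by apply: (cvgr_gt _ c); rewrite horner_wpoly.
near=> t.
have t0 : 0 < t by near: t; exact: nbhs_left_gt.
have tt : t < tau by near: t; exact: nbhs_left_lt.
have large : 2 * W < (wpoly w K).[t] by near: t.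
have t0' := ltW t0.
have := Phi_gt0 _ t0'; have := Phi_lt_rho _ t0' _; rewrite rE lte_fin => /(_ tt).
have PhiW : ((2 * W)%:E <= Phi w t)%E.
  apply: le_trans (psum_le_nneseries _ K (weight_term_ge0 _ t0')).
  by rewrite lee_fin -horner_wpoly ltW.
rewrite /Psi; case PhiE: (Phi w t) PhiW => [F| |] //; rewrite lee_fin => WF _.
rewrite lte_fin => F0; rewrite inver gt_eqF //.
case TE: (tPhi' w t) => [D| |].
- rewrite -EFinM lee_fin ler_pdivlMr //.
  have DK J : \sum_(k < J) k%:R * w k * t ^+ k <= D.
    by rewrite -lee_fin -TE; apply: psum_le_nneseries; exact: mean_term_ge0.
  have : (Phi w t <= (D / (2 * A1) + W)%:E)%E.
    apply: nneseries_le_psum; first exact: weight_term_ge0.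
    move=> J; apply: le_trans (ler_psum_widen (fun k => w k * t ^+ k) _ _ (leq_addr L J) _) _.
      by move=> k _; exact: weight_term_ge0.
    apply: le_trans (_ : \sum_(k < J + L) (k%:R * w k * t ^+ k / (2 * A1)
        + (if (k < L)%N then w k * tau ^+ k else 0)) <= _).
      apply: ler_sum => k _; case: ltnP => kL.
        rewrite ler_wpDl ?divr_ge0 ?mean_term_ge0 ?mulr_ge0 ?(ltW A10) //.
        by rewrite ler_wpM2l // lerXn2r ?nnegrE // ltW.
      rewrite addr0 ler_pdivlMr ?mulr_gt0 // mulrC -mulrA.
      by rewrite ler_wpM2r ?weight_term_ge0 // HL.
    rewrite big_split /= (psum_truncate (fun k => w k * tau ^+ k)) ?leq_addl // lerD2r -mulr_suml.
    apply: ler_wpM2r; last exact: DK.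
    by rewrite invr_ge0 mulr_ge0 // ltW.
  rewrite PhiE lee_fin => FD.
  have FA : F * (2 * A1) <= 2 * D.
    have : F / 2 <= D / (2 * A1) by lra.
    rewrite ler_pdivlMr ?mulr_gt0 //; lra.
  have := ler_wpM2r (ltW F0) AA1; lra.
- by rewrite gt0_mulye ?leey // lte_fin invr_gt0.
- have : (0 <= tPhi' w t)%E.
    by apply: nneseries_ge0 => k _ _; rewrite lee_fin mean_term_ge0.
  by rewrite TE.
Unshelve. all: by end_near.
Qed.

(** Otherwise [w k <= T ^+ k] from index [a] on, and comparison with a geometric series gives
    convergence at [1 / (2 * T) > 0]. *)
Lemma weights_superexponential : (rho_w w <= 0)%E -> forall a (T : R), 0 < T ->
  exists2 k : nat, (a <= k)%N & T ^+ k <= w k.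
Proof.
move=> r0 a T T0; apply: contrapT => nk.
have small k : (a <= k)%N -> w k <= T ^+ k.
  by move=> ak; rewrite leNgt; apply/negP => /ltW Tw; apply: nk; exists k.
pose t := (2 * T)^-1.
have t0 : 0 < t by rewrite invr_gt0 mulr_gt0.
pose c := 1 + \sum_(k < a) w k * t ^+ k * 2 ^+ k.
have s0 k : 0 <= w k * t ^+ k * 2 ^+ k.
  by rewrite mulr_ge0 ?exprn_ge0 // weight_term_ge0 // ltW.
have c1 : 1 <= c by rewrite lerDl sumr_ge0.
have uc k : w k * t ^+ k <= c * (1 / 2) ^+ k.
  rewrite expr_div_n expr1n mulrA mulr1 ler_pdivlMr ?exprn_gt0 //.
  have [ka|ak] := ltnP k a.
    rewrite /c (bigD1 (Ordinal ka)) //= addrCA lerDl addr_ge0 // sumr_ge0 //.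
  apply: le_trans c1.
  apply: le_trans (_ : T ^+ k * t ^+ k * 2 ^+ k <= _).
    by rewrite !ler_wpM2r ?exprn_ge0 ?small // ltW.
  rewrite -!exprMn (_ : T * t * 2 = 1) ?expr1n // /t.
  by field; rewrite gt_eqF.
have Pt : ~~ (Phi w t < +oo)%E by apply: Phi_gt_rho (ltW t0) _; exact: le_lt_trans r0 _.
have [K] := psum_unbounded t (2 * c) (ltW t0) Pt.
apply/negP; rewrite -leNgt.
apply: le_trans (_ : \sum_(k < K) c * (1 / 2) ^+ k <= _); first exact: ler_sum.
rewrite -mulr_sumr mulrC ler_wpM2r ?(le_trans ler01) //.
have : \sum_(k < K) (1 / 2 : R) ^+ k = 2 - 2 * (1 / 2) ^+ K.
  elim: K => [|K ih]; first by rewrite big_ord0 expr0; lra.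
  by rewrite big_ord_recr /= ih exprS; lra.
move=> ->; have : 0 <= (1 / 2 : R) ^+ K by rewrite exprn_ge0.
lra.
Qed.

End ExtendedReals.

(** * The case [tau > 0] after rescaling, and the conclusion *)

(** [F] and [D] are the total mass and the first moment of the rescaled weights. Either the mean is
    exactly [lam], and a fixed [b] serves because the deficit tends to zero; or the series diverges
    beyond [1], and [b] close to [1] makes [ln b] small against a bounded deficit. *)
Lemma zero_part_cvg_core {R : realType} (v : nat -> R) (lam F D : R) k0 :
  weight_seq v -> 0 < v 0%N -> 0 < lam -> lam < k0%:R -> 0 < v k0 ->
  (forall K, \sum_(k < K) v k <= F) ->
  (forall e, 0 < e -> exists K, F - e <= \sum_(k < K) v k) ->
  (forall K, \sum_(k < K) k%:R * v k <= D) ->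
  (forall e, 0 < e -> exists K, D - e <= \sum_(k < K) k%:R * v k) ->
  D <= lam * F ->
  D = lam * F \/ (forall b B : R, 1 < b -> exists K, B < \sum_(k < K) v k * b ^+ k) ->
  zero_part_cvg v lam F.
Proof.
move=> v_ge0 v0 lam0 lamk vk vF Fv vD Dv DF crit.
have F0 : 0 < F by apply: lt_le_trans (vF 1%N); rewrite big_ord1.
have kv0 k : 0 <= k%:R * v k by rewrite mulr_ge0.
have AE K : \sum_(k < K) (k%:R - lam) * v k
    = \sum_(k < K) k%:R * v k - lam * \sum_(k < K) v k.
  by rewrite mulr_sumr -sumrB; apply: eq_bigr => k _; ring.
(* Terms with [k >= lam] are nonnegative, so a positive partial sum would persist in the limit
   [D - lam * F <= 0]. *)
have A0 K : \sum_(k < K) (k%:R - lam) * v k <= 0.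
  have [Kl|lK] := lerP K%:R lam.
    rewrite -oppr_ge0 -sumrN sumr_ge0 // => k _; rewrite -mulNr mulr_ge0 //.
    by rewrite opprB subr_ge0 (le_trans _ Kl) // ler_nat ltnW.
  rewrite leNgt; apply/negP => AK.
  have [K1 HK1] := Fv _ (divr_gt0 AK (mulr_gt0 (ltr0n R 2) lam0)).
  have wide : \sum_(k < K) (k%:R - lam) * v k <= \sum_(k < K + K1) (k%:R - lam) * v k.
    apply: (ler_psum_widen (fun k => (k%:R - lam) * v k)); first exact: leq_addr.
    move=> k Kk; rewrite mulr_ge0 // subr_ge0 (le_trans (ltW lK)) // ler_nat //.
  have := le_trans HK1 (ler_psum_widen v _ _ (leq_addl K K1) (fun k _ => v_ge0 k)).
  move/(ler_wpM2l (ltW lam0)); rewrite mulrBr.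
  rewrite (_ : lam * (_ / _) = (\sum_(k < K) (k%:R - lam) * v k) / 2); last first.
    by field; rewrite gt_eqF.
  have := vD (K + K1)%N; move: wide; rewrite (AE (K + K1)%N); lra.
apply: zero_part_cvg_tilted => //; apply: (@Z_lower_bound _ v lam F k0) => //.
apply: tilt_truncation => // e e0.
case: crit => [DE|heavy].
- have gap : 0 < (k0%:R - lam) * v k0 by rewrite mulr_gt0 // subr_gt0.
  (* At this [b] the single term [k0] outweighs all negative terms, whose indices are below [lam]
     and hence at most [k0 - 1]. *)
  pose b := 1 + lam * F / ((k0%:R - lam) * v k0).
  have b1 : 1 <= b by rewrite lerDl divr_ge0 ?(ltW gap) ?mulr_ge0 ?ltW.
  have bgap : lam * F <= (k0%:R - lam) * v k0 * b.
    by rewrite /b mulrDr mulr1 mulrCA divff ?gt_eqF // mulr1 lerDr ltW.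
  have lb0 : 0 <= ln b by exact: ln_ge0.
  have [K1 HK1] := Dv (e / (ln b + 1)) (divr_gt0 e0 (ltr_wpDl lb0 ltr01)).
  exists b, (k0.+1 + K1)%N; split => // K KK; split.
    have bk1 : 0 <= b ^+ k0.-1 by rewrite exprn_ge0 // (le_trans ler01).
    have kK : (k0 < K)%N by apply: leq_trans KK; rewrite leq_addr.
    apply: le_trans (_ : \sum_(k < K) (- lam * b ^+ k0.-1 * v k +
        (if k == k0 :> nat then (k0%:R - lam) * v k0 * b ^+ k0 else 0)) <= _).
      rewrite big_split /= -mulr_sumr -big_mkcond /= [X in _ + X](big_pred1 (Ordinal kK)) //.
      have kE : b ^+ k0 = b * b ^+ k0.-1.
        by rewrite -exprS prednK // -(ltr0n R) (lt_trans lam0).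
      have := ler_wpM2r bk1 bgap; have := ler_wpM2l (ltW lam0) (vF K).
      move=> /(ler_wpM2r bk1); rewrite kE; lra.
    apply: ler_sum => k _; have bk0 : 0 <= b ^+ k by rewrite exprn_ge0 // (le_trans ler01).
    have lbv : 0 <= lam * b ^+ k0.-1 * v k by rewrite !mulr_ge0 // ltW.
    have [kE|_] := eqVneq (k : nat) k0; first by move: lbv; rewrite kE !mulNr /=; lra.
    rewrite addr0; have [lk|kl] := lerP lam k%:R.
      have : 0 <= (k%:R - lam) * v k * b ^+ k by rewrite !mulr_ge0 // subr_ge0.
      rewrite !mulNr; lra.
    have bb : b ^+ k <= b ^+ k0.-1.
      apply: ler_weXn2l => //; rewrite -ltnS prednK; last by rewrite -(ltr0n R) (lt_trans lam0).
      by rewrite -(ltr_nat R) (lt_trans kl).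
    have := ler_wpM2l (mulr_ge0 (ltW lam0) (v_ge0 k)) bb.
    have : 0 <= k%:R * v k * b ^+ k by rewrite mulr_ge0.
    lra.
  rewrite AE; have := le_trans HK1 (ler_psum_widen (fun k => k%:R * v k) _ _
     (leq_trans (leq_addl _ _) KK) (fun k _ => kv0 k)) => H.
  have := ler_wpM2l (ltW lam0) (vF K) => H'.
  rewrite -mulrN; set X := - _; have XE : X <= e / (ln b + 1) by rewrite /X; lra.
  have := ler_wpM2l lb0 XE => /le_trans; apply.
  rewrite mulrA ler_pdivrMr ?ltr_wpDl //; lra.
- pose l := e / (lam * F + 1); have lF0 : 0 < lam * F + 1 by rewrite addr_gt0 ?mulr_gt0.
  have l0 : 0 < l by rewrite divr_gt0.
  have b1 : 1 < expR l by rewrite expR_gt1.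
  have [L HL] := @eventually_ge_nat R (lam + 1).
  pose u k := v k * expR l ^+ k.
  have u0 k : 0 <= u k by rewrite mulr_ge0 ?exprn_ge0 ?expR_ge0.
  (* From index [L] on, [k - lam >= 1]; the divergent mass there compensates the first [L] terms. *)
  have [K1 HK1] := heavy (expR l) ((lam + 1) * \sum_(k < L) u k) b1.
  exists (expR l), (L + K1)%N; split=> [|K KK]; first exact: ltW.
  split.
    have LK : (L <= K)%N by apply: leq_trans KK; rewrite leq_addr.
    apply: le_trans (_ : \sum_(k < K) (u k + - (lam + 1) * (if (k < L)%N then u k else 0)) <= _).
      rewrite big_split /= -mulr_sumr (psum_truncate u) // mulNr subr_ge0.
      apply: le_trans (ltW HK1) _; apply: (ler_psum_widen u) => //.
      by apply: leq_trans KK; rewrite leq_addl.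
    apply: ler_sum => k _; rewrite -mulrA -/(u k); case: ltnP => kL.
      have := mulr_ge0 (ler0n R k) (u0 k); lra.
    have := ler_wpM2r (u0 k) (HL k kL); lra.
  rewrite expRK AE -mulrN.
  have X : - (\sum_(k < K) k%:R * v k - lam * \sum_(k < K) v k) <= lam * F + 1.
    have := ler_wpM2l (ltW lam0) (vF K).
    have : 0 <= \sum_(k < K) k%:R * v k by rewrite sumr_ge0.
    lra.
  apply: le_trans (ler_wpM2l (ltW l0) X) _.
  by rewrite /l divfK // gt_eqF.
Qed.

Theorem theorem17p9 (R : realType) (w : nat -> R) (m : nat -> nat)
    (lam tau : R) :
  weight_seq w ->
  0 < w 0%N ->
  (exists k : nat, (1 <= k)%N /\ 0 < w k) ->
  (fun n : nat => (m n)%:R / n%:R) @ \oo --> lam ->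
  0 <= lam -> (lam%:E < omega_w w)%E ->
  (* tau: the unique number in [0, rho] with Psi(tau) = lam if lam <= nu,
     and tau = rho if lam > nu *)
  ((lam%:E <= nu_w w)%E ->
      [/\ 0 <= tau, (tau%:E <= rho_w w)%E & Psi_bar w tau = lam%:E]) ->
  ((nu_w w < lam%:E)%E -> tau%:E = rho_w w) ->
  (fun n : nat => (Z w (m n) n.+1 / Z w (m n) n)%:E)
     @ within [set n : nat | 0 < Z w (m n) n] \oo --> Phi w tau.
Proof.
move=> w_ge0 w0 [k1 [k10 wk1]] mlam lam0 lamw sub super.
have rho0 : (0 <= rho_w w)%E.
  by apply: ereal_sup_ubound; exists 0 => //; split => //; exact: Phi0_lty.
(* An infinite [Phi tau] would make [nu] infinite, against [Psi_bar w tau = lam] in one case and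
   [nu < lam] in the other. *)
have [tau0 [tr [Pfin PsiE]]] : 0 <= tau /\ (tau%:E <= rho_w w)%E /\
    (Phi w tau < +oo)%E /\ (Psi w tau = lam%:E \/
      (Psi w tau <= lam%:E)%E /\ rho_w w = tau%:E).
  have [/sub[tau0 tr]|/[dup] nul /super tr] := leP (lam%:E) (nu_w w).
    rewrite /Psi_bar; case: ifP => [Pt ->|/negbT Pt]; first by do !split => //; left.
    by rewrite (nu_pinfty w w_ge0 w0 _ tau0 tr Pt).
  have tau0 : 0 <= tau by rewrite -lee_fin tr.
  have Pt : (Phi w tau < +oo)%E.
    apply/negPn/negP => Pt; move: nul.
    by rewrite (nu_pinfty w w_ge0 w0 _ tau0 _ Pt) ?tr // ltNge leey.
  do !split => //; first by rewrite tr.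
  by right; split => //; move: nul; rewrite /nu_w -tr Pt => /ltW.
have := Phi_gt0 w w_ge0 w0 _ tau0.
case PhiE: (Phi w tau) Pfin => [F| |] // _; rewrite lte_fin => F0.
have [D TE] : exists D, tPhi' w tau = D%:E.
  have : (0 <= tPhi' w tau)%E.
    by apply: nneseries_ge0 => k _ _; rewrite lee_fin mean_term_ge0.
  case TE: (tPhi' w tau) => [D| |] // _; first by exists D.
  have Py : Psi w tau = +oo%E.
    by rewrite /Psi TE PhiE inver gt_eqF // gt0_mulye // lte_fin invr_gt0.
  by case: PsiE => [|[]]; rewrite Py.
have PsiR : Psi w tau = (D / F)%:E by rewrite /Psi TE PhiE inver gt_eqF // EFinM.
have crit : D <= lam * F /\ (D = lam * F \/ rho_w w = tau%:E).
  case: PsiE; rewrite PsiR.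
    by move=> [<-]; rewrite divfK ?gt_eqF //; split => //; left.
  by rewrite lee_fin ler_pdivrMr // => -[DF rE]; split => //; right.
have partF K : \sum_(k < K) w k * tau ^+ k <= F.
  by rewrite -lee_fin -PhiE psum_le_nneseries //; exact: weight_term_ge0.
have partD K : \sum_(k < K) k%:R * w k * tau ^+ k <= D.
  by rewrite -lee_fin -TE psum_le_nneseries //; exact: mean_term_ge0.
apply: (@Z_ratio_cvg _ _ _ lam) => //.
have [tau_gt0|tauN] := ltrP 0 tau; last first.
  have {tauN}tauE : tau = 0 by apply/le_anti; rewrite tauN.
  have FE : F = w 0%N.
    apply/le_anti; rewrite -lee_fin -PhiE; apply/andP; split.
      apply: nneseries_le_psum; first exact: weight_term_ge0.
      case=> [|K]; first by rewrite big_ord0 ltW.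
      rewrite big_ord_recl expr0 mulr1 big1 ?addr0 // => i _.
      by rewrite tauE exprS mul0r mulr0.
    by have := partF 1%N; rewrite big_ord1 expr0 mulr1.
  rewrite FE; apply: zero_part_cvg_degenerate => // lam_gt0.
  (* At [tau = 0] the first moment vanishes, so [D = lam * F] is impossible for [lam > 0], and the
     radius of convergence must be [0]. *)
  apply: weights_superexponential => //.
  case: crit => _ [DE|->]; last by rewrite tauE.
  have : (tPhi' w tau <= 0)%E.
    apply: nneseries_le_psum; first exact: mean_term_ge0.
    move=> K; rewrite big1 // => -[[|k] /= _] _; first by rewrite !mul0r.
    by rewrite tauE exprS mul0r mulr0.
  by rewrite TE lee_fin DE leNgt mulr_gt0.
have lam_gt0 : 0 < lam.
  have : 0 < lam * F.
    apply: lt_le_trans crit.1; apply: lt_le_trans (partD k1.+1).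
    rewrite big_ord_recr /= ltr_wpDl ?sumr_ge0 // => [k _|]; first exact: mean_term_ge0.
    by rewrite !mulr_gt0 ?exprn_gt0 // ltr0n.
  by rewrite pmulr_lgt0.
have [_ [k0 wk0 <-]] := ereal_sup_gt lamw; rewrite lte_fin => lamk.
apply: (zero_part_cvg_scale w tau) => //.
have sumE K : \sum_(k < K) k%:R * (w k * tau ^+ k) = \sum_(k < K) k%:R * w k * tau ^+ k.
  by apply: eq_bigr => k _; rewrite mulrA.
apply: (@zero_part_cvg_core _ _ lam F D k0) => //.
- by move=> k; exact: weight_term_ge0.
- by rewrite expr0 mulr1.
- by rewrite mulr_gt0 ?exprn_gt0.
- move=> e e0; apply: contrapT => nK.
  have : (Phi w tau <= (F - e)%:E)%E.
    apply: nneseries_le_psum; first exact: weight_term_ge0.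
    by move=> K; rewrite leNgt; apply/negP => /ltW FK; apply: nK; exists K.
  rewrite PhiE lee_fin; lra.
- by move=> K; rewrite sumE.
- move=> e e0; apply: contrapT => nK.
  have : (tPhi' w tau <= (D - e)%:E)%E.
    apply: nneseries_le_psum; first exact: mean_term_ge0.
    by move=> K; rewrite leNgt; apply/negP => /ltW FK; apply: nK; exists K; rewrite sumE.
  rewrite TE lee_fin; lra.
- exact: crit.1.
case: crit => _ [DE|rE]; [by left | right => b B b1].
have tb0 : 0 <= tau * b by rewrite mulr_ge0 // (le_trans ler01) // ltW.
(* With [tau = rho], the point [tau * b] lies beyond the radius of convergence. *)
have [|K HK] := psum_unbounded w w_ge0 _ B tb0.
  by apply: Phi_gt_rho => //; rewrite rE lte_fin ltr_pMr.
by exists K; move: HK; under eq_bigr do rewrite exprMn mulrA.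
Qed.
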